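(* Let $\bar u_h \in U_{ad}$, $\bar y_h \in X_{h0}$, $\bar p_h \in X_{h0}$ and real numbers $(\bar\mu_j)_{x_j\in\mathcal N_h}$ be such that $(\bar y_h(x_j))_{x_j\in\mathcal N_h}\in Y^h_{ad}$ and $$\int_\Omega \nabla \bar y_h\cdot\nabla v_h+\phi(\bar y_h)v_h\,dx=\int_\Omega \bar u_h v_h\,dx\qquad\forall\, v_h\in X_{h0},$$ $$\int_\Omega \nabla \bar p_h\cdot\nabla v_h+\phi'(\bar y_h)\bar p_h v_h\,dx=\int_\Omega(\bar y_h-y_0)v_h\,dx+\sum_{x_j\in\mathcal N_h}\bar\mu_j v_h(x_j)\qquad\forall\, v_h\in X_{h0},$$ $$\int_\Omega(\bar p_h+\alpha\bar u_h)(u-\bar u_h)\,dx\ge 0\qquad\forall\, u\in U_{ad},$$ $$\sum_{x_j\in\mathcal N_h}\bar\mu_j\,(z_j-\bar y_h(x_j))\le 0\qquad\forall\,(z_j)_{x_j\in\mathcal N_h}\in Y^h_{ad}.$$ If $$\|\bar p_h\|_{L^q(\Omega)}\le \eta(\alpha,r),$$ then $\bar u_h$ is a global minimum for Problem $(\mathbb P_h)$. If this inequality is strict, then $\bar u_h$ is the unique global minimum of $(\mathbb P_h)$.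
   Context: Data. $\Omega\subset\mathbb R^2$ is a bounded, convex, polygonal domain; $\alpha>0$; $y_0\in L^2(\Omega)$. The function $\phi:\mathbb R\to\mathbb R$ is of class $C^2$ and monotonically increasing (so $\phi'\ge 0$), and there are constants $r>1$ and $M>0$ with $|\phi''(s)|\le M\,\phi'(s)^{1/r}$ for all $s\in\mathbb R$. $K\subset\Omega$ is a (possibly empty) compact set, $y_a,y_b\in C_0(\Omega)$ (continuous functions on $\bar\Omega$ vanishing on $\partial\Omega$) with $y_a(x)<y_b(x)$ for $x\in K$. With given constants $-\infty\le u_a\le u_b\le\infty$, $U_{ad}=\{u\in L^2(\Omega): u_a\le u(x)\le u_b \text{ a.e. in }\Omega\}$. Discretization. $\mathcal T_h$ is an admissible (conforming) triangulation of $\Omega$ into triangles $T$, regarded as closed, whose union is $\bar\Omega$. $X_{h0}$ is the space of $v_h\in C(\bar\Omega)$ that are linear polynomials on each $T\in\mathcal T_h$ and vanish on $\partial\Omega$. For $u\in L^2(\Omega)$, $\mathcal G_h(u)\in X_{h0}$ denotes the unique $y_h\in X_{h0}$ with $\int_\Omega\nabla y_h\cdot\nabla v_h+\phi(y_h)v_h\,dx=\int_\Omega u v_h\,dx$ for all $v_h\in X_{h0}$. $\mathcal N_h$ is the set of all $x_j$ that are vertices of some $T\in\mathcal T_h$ with $T\cap K\ne\emptyset$, and $Y^h_{ad}=\{(z_j)_{x_j\in\mathcal N_h}: y_a(x_j)\le z_j\le y_b(x_j),\ x_j\in\mathcal N_h\}$. Problem $(\mathbb P_h)$: minimize $J_h(u)=\frac12\|y_h-y_0\|_{L^2(\Omega)}^2+\frac\alpha2\|u\|_{L^2(\Omega)}^2$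 over $u\in U_{ad}$ subject to $y_h=\mathcal G_h(u)$ and $(y_h(x_j))_{x_j\in\mathcal N_h}\in Y^h_{ad}$. A global minimum is a feasible control $\bar u_h$ with $J_h(\bar u_h)\le J_h(u)$ for all feasible $u$. Constants. $q:=\frac{3r-2}{r-1}$, $\rho:=\frac{r+q}{rq}$, and $C_q>0$ is an upper bound on the optimal constant $C$ in the Gagliardo–Nirenberg inequality $\|f\|_{L^q(\mathbb R^2)}\le C\|f\|_{L^2(\mathbb R^2)}^{2/q}\|\nabla f\|_{L^2(\mathbb R^2)}^{(q-2)/q}$, $f\in H^1(\mathbb R^2)$. Finally $$\eta(\alpha,r):=\alpha^{\frac\rho2}\,C_q^{\frac{2-2r}{r}}\,M^{-1}\Big(\frac{r-1}{2r-1}\Big)^{\frac{1-r}{r}}q^{1/q}\,r^{1/r}\,\rho^{\rho/2}\,(2-\rho)^{\frac\rho2-1}.$$ *)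

(* Defs.v *)
From mathcomp Require Import all_boot all_order all_algebra.
From mathcomp Require Import all_classical all_reals all_analysis.

Set Implicit Arguments.
Unset Strict Implicit.
Unset Printing Implicit Defensive.

Import Order.TTheory GRing.Theory Num.Theory.
Import numFieldNormedType.Exports.

Local Open Scope ring_scope.
Local Open Scope classical_set_scope.

Notation plane R := (R * R)%type.

Section Plane.
Context {R : realType}.
Implicit Types (x y : plane R) (f g : plane R -> R) (D : set (plane R)).

(* Two-dimensional Lebesgue measure on Borel sets. Elements of L^p(D) are
   represented by Borel functions, since each Lebesgue class contains one. *)
Definition leb2
  : {measure set (measurableTypeR R * measurableTypeR R) -> \bar R} :=
  (@lebesgue_measure R \x @lebesgue_measure R)%E.

Definition Lp_norm D (p : R) f : \bar R :=
  ('N[leb2]_(p%:E)[EFin \o (f \_ D)])%E.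

Definition in_L2 D f : Prop :=
  measurable_fun D f /\ (Lp_norm D 2 f < +oo)%E.

Definition e1 : plane R := (1, 0).
Definition e2 : plane R := (0, 1).

(* For a continuous piecewise linear function this is the gradient inside each
   triangle, hence the weak gradient almost everywhere; the junk values of the
   derivatives on the edges live on a null set. *)
Definition grad_dot f g x : R :=
  'D_e1 f x * 'D_e1 g x + 'D_e2 f x * 'D_e2 g x.

(* [s] lists the coordinates along which [f] is successively differentiated. *)
Definition iter_partial (s : seq bool) f : plane R -> R :=
  foldr (fun (b : bool) h => 'D_(if b then e2 else e1) h) f s.

Definition smooth f : Prop := forall s : seq bool,
  [/\ continuous (iter_partial s f),
      forall x, derivable (iter_partial s f) x e1 &
      forall x, derivable (iter_partial s f) x e2].

Definition test_function f : Prop :=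
  smooth f /\ compact (closure [set x | f x != 0]).

(* [f] is in H^1(R^2) with weak gradient [(g1, g2)]. *)
Definition in_H1_with_grad f (g1 g2 : plane R -> R) : Prop :=
  [/\ in_L2 setT f, in_L2 setT g1, in_L2 setT g2 &
      forall psi, test_function psi ->
        \int[leb2]_x (f x * 'D_e1 psi x) = - (\int[leb2]_x (g1 x * psi x)) /\
        \int[leb2]_x (f x * 'D_e2 psi x) = - (\int[leb2]_x (g2 x * psi x))].

Definition gagliardo_nirenberg (q C : R) : Prop :=
  forall f g1 g2, in_H1_with_grad f g1 g2 ->
  (Lp_norm setT q f <=
   C%:E * (Lp_norm setT 2 f) `^ (2 / q)
     * (Lp_norm setT 2 (fun x => Num.sqrt (g1 x ^+ 2 + g2 x ^+ 2)))
         `^ ((q - 2) / q))%E.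

(* The infimum is [+oo] if no constant is admissible. *)
Definition gn_optimal (q : R) : \bar R :=
  ereal_inf [set C%:E | C in [set C : R | 0 <= C /\ gagliardo_nirenberg q C]].

Definition segment (a b : plane R) : set (plane R) :=
  [set x | exists2 t : R, 0 <= t <= 1 & x = (1 - t) *: a + t *: b].

Definition triangle (a : 'I_3 -> plane R) : set (plane R) :=
  [set x | exists l : 'I_3 -> R,
    [/\ forall k, 0 <= l k, \sum_k l k = 1 & x = \sum_k l k *: a k]].

Definition nondegenerate_triangle (a : 'I_3 -> plane R) : Prop :=
  let u := a (inord 1) - a ord0 in let v := a (inord 2) - a ord0 in
  u.1 * v.2 - u.2 * v.1 != 0.

Definition convex_polygonal_domain (Omega : set (plane R)) : Prop :=
  [/\ open Omega, Omega !=set0, bounded_set Omega, convex_set Omega &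
      exists s : seq (plane R * plane R),
        closure Omega `\` Omega =
          \bigcup_(ab in [set` s]) segment ab.1 ab.2].

(* [Th i k], k = 0, 1, 2, are the vertices of the i-th triangle. *)
Definition conforming_triangulation (Omega : set (plane R)) (n : nat)
    (Th : 'I_n -> 'I_3 -> plane R) : Prop :=
  [/\ forall i, nondegenerate_triangle (Th i),
      \bigcup_i triangle (Th i) = closure Omega &
      forall i j, i != j ->
        let I := triangle (Th i) `&` triangle (Th j) in
        [\/ I = set0,
            exists k l, Th i k = Th j l /\ I = [set Th i k] |
            exists k k' l l',
              [/\ k != k', Th i k = Th j l, Th i k' = Th j l' &
                  I = segment (Th i k) (Th i k')]]].

(* Only the values on [closure Omega] matter. *)
Definition in_C0 (Omega : set (plane R)) f : Prop :=
  {within closure Omega, continuous f} /\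
  (forall x, (closure Omega `\` Omega) x -> f x = 0).

Definition affine_on D f : Prop :=
  exists c d1 d2 : R, forall x, D x -> f x = c + d1 * x.1 + d2 * x.2.

(* Functions on [closure Omega] vanishing on the boundary are extended by zero
   to the plane, so that equality in X_h0 is equality of functions. *)
Definition in_Xh0 (Omega : set (plane R)) (n : nat)
    (Th : 'I_n -> 'I_3 -> plane R) f : Prop :=
  [/\ in_C0 Omega f, forall i, affine_on (triangle (Th i)) f &
      forall x, ~ closure Omega x -> f x = 0].

Definition class_C2 (phi : R -> R) : Prop :=
  [/\ forall s, derivable phi s 1, forall s, derivable (derive1 phi) s 1 &
      continuous (derive1 (derive1 phi))].

Definition in_Uad (Omega : set (plane R)) (ua ub : \bar R)
    (u : plane R -> R) : Prop :=
  in_L2 Omega u /\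
  {ae leb2, forall x, Omega x -> (ua <= (u x)%:E <= ub)%E}.

Definition state_nodes (K : set (plane R)) (n : nat)
    (Th : 'I_n -> 'I_3 -> plane R) : set (plane R) :=
  [set x | exists i k, Th i k = x /\ triangle (Th i) `&` K !=set0].

(* A family indexed by the nodes is a function on the plane of which only the
   values at the nodes are used. *)
Definition in_Yad (N : set (plane R)) (ya yb z : plane R -> R) : Prop :=
  forall x, N x -> ya x <= z x <= yb x.

Definition solves_state (Omega : set (plane R)) (n : nat)
    (Th : 'I_n -> 'I_3 -> plane R) (phi : R -> R)
    (u y : plane R -> R) : Prop :=
  forall v, in_Xh0 Omega Th v ->
    \int[leb2]_(x in Omega) (grad_dot y v x + phi (y x) * v x) =
    \int[leb2]_(x in Omega) (u x * v x).

(* The discrete solution operator, with junk value 0 where the discrete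
   equation has no solution in X_h0. *)
Definition Gh (Omega : set (plane R)) (n : nat)
    (Th : 'I_n -> 'I_3 -> plane R) (phi : R -> R)
    (u : plane R -> R) : plane R -> R :=
  xget (cst 0)
    [set y | in_Xh0 Omega Th y /\ solves_state Omega Th phi u y].

(* The two middle conjuncts of [feasible] exclude the junk value of [Gh]. *)
Definition feasible (Omega K : set (plane R)) (n : nat)
    (Th : 'I_n -> 'I_3 -> plane R) (phi : R -> R) (ya yb : plane R -> R)
    (ua ub : \bar R) (u : plane R -> R) : Prop :=
  let y := Gh Omega Th phi u in
  [/\ in_Uad Omega ua ub u, in_Xh0 Omega Th y,
      solves_state Omega Th phi u y &
      in_Yad (state_nodes K Th) ya yb y].

Definition Jh (Omega : set (plane R)) (n : nat)
    (Th : 'I_n -> 'I_3 -> plane R) (phi : R -> R) (y0 : plane R -> R)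
    (alpha : R) (u : plane R -> R) : R :=
  2^-1 * fine (Lp_norm Omega 2 (Gh Omega Th phi u \- y0)) ^+ 2 +
  alpha / 2 * fine (Lp_norm Omega 2 u) ^+ 2.

Definition global_minimum (Omega K : set (plane R)) (n : nat)
    (Th : 'I_n -> 'I_3 -> plane R) (phi : R -> R) (y0 ya yb : plane R -> R)
    (ua ub : \bar R) (alpha : R) (ubar : plane R -> R) : Prop :=
  feasible Omega K Th phi ya yb ua ub ubar /\
  forall u, feasible Omega K Th phi ya yb ua ub u ->
    Jh Omega Th phi y0 alpha ubar <= Jh Omega Th phi y0 alpha u.

End Plane.

Section Constants.
Context {R : realType}.

Definition qexp (r : R) : R := (3 * r - 2) / (r - 1).

Definition rho (r : R) : R := (r + qexp r) / (r * qexp r).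

Definition eta (alpha r M Cq : R) : R :=
  let q := qexp r in
  alpha `^ (rho r / 2) * Cq `^ ((2 - 2 * r) / r) * M^-1 *
  ((r - 1) / (2 * r - 1)) `^ ((1 - r) / r) * q `^ q^-1 * r `^ r^-1 *
  rho r `^ (rho r / 2) * (2 - rho r) `^ (rho r / 2 - 1).

End Constants.

(* Main.v *)
Require Import Defs.
From mathcomp Require Import all_boot all_order all_algebra.
From mathcomp Require Import all_classical all_reals all_analysis.
From mathcomp Require Import measurable_realfun ring lra.

Set Implicit Arguments.
Unset Strict Implicit.
Unset Printing Implicit Defensive.

Import Order.TTheory GRing.Theory Num.Theory.
Import numFieldNormedType.Exports.

Local Open Scope ring_scope.
Local Open Scope classical_set_scope.

(** For a feasible pair [(u, y)] put [d = y - ybar] and [w = u - ubar]. Testing the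
    adjoint equation with [d] and the difference of the state equations with
    [pbar] gives
      J(u) - J(ubar) >= 1/2 |d|^2 + alpha/2 |w|^2 - R,
    where [R] is the integral of [pbar] times the second order Taylor remainder
    of [phi] at [ybar]. The growth condition on [phi''] bounds this remainder
    pointwise by a multiple of [|d|^(2-2/r) psi^(1/r)], where
    [psi = (phi y - phi ybar) d >= 0]. Hoelder's inequality, the
    Gagliardo-Nirenberg inequality for [d], and the energy identity
    |grad d|^2 + int psi = int w d then yield
      eta R <= |pbar|_q (1/2 |d|^2 + alpha/2 |w|^2).
    The Gagliardo-Nirenberg inequality is available for finite element functions
    because they are Lipschitz continuous and affine near every point outside a
    finite union of lines, so that their pointwise gradient is a weak one. *)

(** * Scalar inequalities *)

(** The problem is nonconvex and no smallness of [d] is available, so the remainder must be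
    dominated by a quadratic form in the norms of [d] and [w]. This fixes the exponents. Hoelder's
    inequality for |pbar| |d|^(2-2/r) psi^(1/r), with the first two factors measured in L^q and psi
    in L^1, requires 1/q + (2-2/r)/q + 1/r = 1, that is q = (3r-2)/(r-1). For this q the
    Gagliardo-Nirenberg inequality turns |d|_q^(2-2/r) into |d|_2^(2-2 rho) (|grad d|_2^2)^(1/q)
    with rho = 1/q + 1/r, and the energy identity bounds (|grad d|_2^2)^(1/q) (int psi)^(1/r) by a
    multiple of (|w|_2 |d|_2)^rho. What remains is |d|_2^(2-rho) |w|_2^rho, homogeneous of degree 2
    like the objective gap. Keeping psi instead of estimating it away is what lets monotonicity of
    [phi] pay for part of the remainder. *)

Section Scalar.
Context {R : realType}.
Implicit Types a b c x y s t l m : R.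

(** This is ln t <= t - 1 at t = a / m, multiplied by [l] and exponentiated. When [m] is the
    weighted mean, the exponents of several such bounds cancel, which gives AM-GM. *)
Lemma powR_le_tangent a m l : 0 <= a -> 0 < m -> 0 <= l ->
  a `^ l <= m `^ l * expR (l * (a / m - 1)).
Proof.
move=> a0 m0; rewrite [0 <= l]le_eqVlt => /predU1P[<-|l0].
  by rewrite !powRr0 mul0r expR0 mulr1.
move: a0; rewrite [0 <= a]le_eqVlt => /predU1P[<-|a0].
  by rewrite powR0 ?gt_eqF// mulr_ge0 ?powR_ge0 ?expR_ge0.
have am0 : 0 < a / m by rewrite divr_gt0.
rewrite -{1}(divfK (lt0r_neq0 m0) a) [a / m * m]mulrC (powRM _ (ltW m0) (ltW am0)).
rewrite ler_wpM2l ?powR_ge0// /powR gt_eqF// ler_expR (ler_wpM2l (ltW l0))//.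
have := @le_ln1Dx R (a / m - 1); rewrite [1 + _]addrC subrK.
by apply; rewrite -subr_gt0 opprK subrK.
Qed.

(** The tangent bounds at the weighted mean [m] are multiplied; their exponents sum to m / m - 1 =
    0. The third weight may be 0, so that the two-term inequality is an instance. *)
Lemma weighted_AMGM3 a b c l1 l2 l3 : 0 <= a -> 0 <= b -> 0 <= c ->
  0 < l1 -> 0 < l2 -> 0 <= l3 -> l1 + l2 + l3 = 1 ->
  a `^ l1 * b `^ l2 * c `^ l3 <= l1 * a + l2 * b + l3 * c.
Proof.
move=> a0 b0 c0 l10 l20 l30 l1E; set m := _ + _ + l3 * c.
have m_ge0 : 0 <= m by rewrite !addr_ge0 ?mulr_ge0// ltW.
have [m0|m0] := ltP 0 m; last first.
  have -> : a = 0.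
    apply/eqP; rewrite eq_le a0 andbT -(pmulr_rle0 _ l10).
    apply: le_trans m0; rewrite /m -addrA lerDl.
    by rewrite addr_ge0// mulr_ge0// ltW.
  by rewrite powR0 ?gt_eqF// !mul0r.
apply: (@le_trans _ _ ((m `^ l1 * expR (l1 * (a / m - 1))) *
   (m `^ l2 * expR (l2 * (b / m - 1))) * (m `^ l3 * expR (l3 * (c / m - 1))))).
  apply: ler_pM; rewrite ?mulr_ge0 ?powR_ge0//.
    by apply: ler_pM; rewrite ?powR_ge0 ?powR_le_tangent// ltW.
  exact: powR_le_tangent.
rewrite [leLHS](_ : _ = (m `^ l1 * m `^ l2 * m `^ l3) * expR
    (l1 * (a / m - 1) + l2 * (b / m - 1) + l3 * (c / m - 1))); last first.
  by rewrite !expRD; ring.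
have mD s t : m `^ s * m `^ t = m `^ (s + t).
  by rewrite powRD // (gt_eqF m0) implybT.
rewrite !mD l1E.
have -> : l1 * (a / m - 1) + l2 * (b / m - 1) + l3 * (c / m - 1) =
   m / m - (l1 + l2 + l3) by rewrite /m; ring.
by rewrite divff ?gt_eqF// l1E subrr expR0 mulr1 powRr1.
Qed.

Lemma weighted_AMGM a b l m : 0 <= a -> 0 <= b -> 0 < l -> 0 < m ->
  l + m = 1 -> a `^ l * b `^ m <= l * a + m * b.
Proof.
move=> a0 b0 l0 m0 lm.
have := @weighted_AMGM3 a b 0 l m 0 a0 b0 (lexx _) l0 m0 (lexx _).
by rewrite addr0 powRr0 mulr1 mulr0 addr0; exact.
Qed.

Lemma qexp_gt2 (r : R) : 1 < r -> 2 < qexp r.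
Proof. move=> r1; rewrite /qexp ltr_pdivlMr; lra. Qed.

Lemma rho_gt0 (r : R) : 1 < r -> 0 < rho r.
Proof.
move=> r1; have := qexp_gt2 r1 => q2.
have r0 : 0 < r by lra.
have q0 : 0 < qexp r by lra.
by rewrite /rho divr_gt0 ?addr_gt0// mulr_gt0.
Qed.

Lemma rho_lt2 (r : R) : 1 < r -> rho r < 2.
Proof.
move=> r1; have := qexp_gt2 r1 => q2.
have r0 : 0 < r by lra.
have q0 : 0 < qexp r by lra.
rewrite /rho ltr_pdivrMr; last by rewrite mulr_gt0.
rewrite /qexp -subr_gt0.
rewrite (_ : _ - _ = ((5 * r - 1) * (r - 1) + 1) / (r - 1)).
  by rewrite divr_gt0//; nra.
by field; rewrite gt_eqF//; lra.
Qed.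

Lemma eta_gt0 (alpha r M Cq : R) : 0 < alpha -> 1 < r -> 0 < M -> 0 < Cq ->
  0 < eta alpha r M Cq.
Proof.
move=> a0 r1 M0 C0.
have := rho_lt2 r1; have := rho_gt0 r1; have := qexp_gt2 r1 => q2 rho0 rho2.
have q0 : 0 < qexp r by lra.
rewrite /eta !mulr_gt0 ?powR_gt0 ?invr_gt0// ?subr_gt0// ?divr_gt0//; lra.
Qed.

(* [D], [Q], [G], [W], [P] stand for |d|_2, |d|_q, |grad d|_2, |w|_2, |pbar|_q and
   [B] for the integral of psi. The constant [eta] comes from two weighted
   AM-GM inequalities: one maximizes G^(2/q) B^(1/r) for given G^2 + B, the other
   compares D^(2-rho) W^rho with the objective gap. *)
Lemma eta_estimate (alpha r M Cq : R) (P D Q G B W Rem : R) :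
  0 < alpha -> 1 < r -> 0 < M -> 0 < Cq ->
  0 <= P -> 0 <= D -> 0 <= Q -> 0 <= G -> 0 <= B -> 0 <= W ->
  Q <= Cq * D `^ (2 / qexp r) * G `^ ((qexp r - 2) / qexp r) ->
  G ^+ 2 + B <= W * D ->
  Rem <= M * ((r - 1) / (2 * r - 1)) `^ ((r - 1) / r) *
    (P * Q `^ (2 - 2 / r) * B `^ r^-1) ->
  eta alpha r M Cq * Rem <= P * (2^-1 * D ^+ 2 + alpha / 2 * W ^+ 2).
Proof.
move=> a0 r1 M0 C0 P0 D0 Q0 G0 B0 W0 gn energy rem.
have := rho_lt2 r1; have := rho_gt0 r1; have := qexp_gt2 r1.
rewrite /eta; set q := qexp r in gn *; set h := rho r => q2 rho0 rho2.
have r0 : 0 < r by lra.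
have q0 : 0 < q by lra.
have r10 : 0 < r - 1 by lra.
have hE : h = q^-1 + r^-1 by rewrite /h /rho -/q; field; rewrite !gt_eqF.
have qE : q = (3 * r - 2) / (r - 1) by [].
set c := (r - 1) / (2 * r - 1) in rem *.
have c0 : 0 < c by rewrite divr_gt0//; lra.
clearbody q h c.
(* The Gagliardo-Nirenberg bound raised to the power 2 - 2/r; the value of [q] makes (q - 2) (1 -
   1/r) = 1 and (2/q) (2 - 2/r) = 2 - 2h. *)
have Qle : Q `^ (2 - 2 / r) <=
    Cq `^ (2 - 2 / r) * D `^ (2 - 2 * h) * (G ^+ 2) `^ q^-1.
  have -> : (G ^+ 2) `^ q^-1 = (G `^ ((q - 2) / q)) `^ (2 - 2 / r).
    rewrite -(powR_mulrn 2 G0) -!powRrM; congr (_ `^ _).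
    by rewrite qE; field; rewrite !gt_eqF//; lra.
  have -> : 2 - 2 * h = 2 / q * (2 - 2 / r).
    by rewrite hE qE; field; rewrite !gt_eqF//; lra.
  rewrite (powRrM D) -!powRM ?mulr_ge0 ?powR_ge0 ?(ltW C0)//.
  apply: ge0_ler_powR; rewrite ?nnegrE ?mulr_ge0 ?powR_ge0 ?(ltW C0)//.
  by rewrite subr_ge0 ler_pdivrMr//; lra.
(* AM-GM for q G^2 and r B with weights (1/q)/h and (1/r)/h, whose weighted mean is (G^2 + B)/h;
   then both sides are raised to the power h. *)
have GB : q `^ q^-1 * r `^ r^-1 * ((G ^+ 2) `^ q^-1 * B `^ r^-1) * h `^ h <= W `^ h * D `^ h.
  have := @weighted_AMGM (q * G ^+ 2) (r * B) (q^-1 / h) (r^-1 / h).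
  move=> /(_ (mulr_ge0 (ltW q0) (sqr_ge0 _)) (mulr_ge0 (ltW r0) B0)).
  have q'0 : 0 < q^-1 / h by rewrite divr_gt0// invr_gt0.
  have r'0 : 0 < r^-1 / h by rewrite divr_gt0// invr_gt0.
  move=> /(_ q'0 r'0); rewrite -mulrDl -hE divff ?gt_eqF// => /(_ erefl) H.
  have {}H : h * ((q * G ^+ 2) `^ (q^-1 / h) * (r * B) `^ (r^-1 / h)) <= W * D.
    apply: le_trans energy; apply: le_trans (ler_wpM2l (ltW rho0) H) _.
    by rewrite le_eqVlt; apply/orP; left; apply/eqP; field; rewrite !gt_eqF.
  have {}H := ge0_ler_powR (ltW rho0) _ _ H.
  rewrite -[X in _ <= X]powRM//; apply: le_trans (H _ _).
  - rewrite powRM ?mulr_ge0 ?powR_ge0 ?(ltW rho0)//.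
    rewrite powRM ?powR_ge0// -!powRrM !divfK ?gt_eqF//.
    rewrite !powRM ?sqr_ge0 ?(ltW q0) ?(ltW r0)//.
    by rewrite le_eqVlt; apply/orP; left; apply/eqP; ring.
  - by rewrite nnegrE !mulr_ge0 ?powR_ge0 ?(ltW rho0).
  - by rewrite nnegrE mulr_ge0.
(* The arguments are scaled by 1/(2 - h) and alpha/h so that the weighted mean with weights 1 - h/2
   and h/2 is exactly the quadratic gap. *)
have DW : D `^ (2 - h) * W `^ h * alpha `^ (h / 2) <=
    (2^-1 * D ^+ 2 + alpha / 2 * W ^+ 2) * ((2 - h) `^ (1 - h / 2) * h `^ (h / 2)).
  have rho20 : 0 < 2 - h by rewrite subr_gt0.
  have := @weighted_AMGM (D ^+ 2 / (2 - h)) (alpha * W ^+ 2 / h) (1 - h / 2) (h / 2).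
  move=> /(_ (divr_ge0 (sqr_ge0 _) (ltW rho20))).
  move=> /(_ (divr_ge0 (mulr_ge0 (ltW a0) (sqr_ge0 _)) (ltW rho0))).
  rewrite divr_gt0// subrK subr_gt0 ltr_pdivrMr// mul1r rho2.
  move=> /(_ isT isT erefl).
  rewrite [X in _ <= X -> _](_ : _ = 2^-1 * D ^+ 2 + alpha / 2 * W ^+ 2); last first.
    by field; rewrite !gt_eqF.
  move=> H; rewrite -ler_pdivrMr ?mulr_gt0 ?powR_gt0//; apply: le_trans H.
  rewrite -(powR_mulrn 2 D0) -(powR_mulrn 2 W0).
  rewrite !powRM ?invr_ge0 ?mulr_ge0 ?powR_ge0 ?(ltW a0) ?(ltW rho0) ?(ltW rho20)//.
  rewrite -!powRrM -(powR_inv1 (ltW rho0)) -(powR_inv1 (ltW rho20)) -!powRrM.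
  have -> : (2%:R * (1 - h / 2)) = 2 - h by field.
  have -> : (2%:R * (h / 2)) = h by field.
  rewrite !mulN1r !powRN.
  by rewrite le_eqVlt; apply/orP; left; apply/eqP; field; rewrite !gt_eqF ?powR_gt0.
have DD : D `^ (2 - 2 * h) * (W `^ h * D `^ h) = D `^ (2 - h) * W `^ h.
  rewrite mulrCA mulrC; congr (_ * _); rewrite -powRD; first by congr (_ `^ _); ring.
  by rewrite (_ : 2 - 2 * h + h == 0 = false)//; apply/negbTE/eqP; lra.
set T := 2^-1 * _ + _ in DW *.
have qr0 : 0 < q `^ q^-1 * r `^ r^-1 by rewrite mulr_gt0// powR_gt0.
have Bq0 : 0 <= B `^ r^-1 by exact: powR_ge0.
have step : q `^ q^-1 * r `^ r^-1 * h `^ h * Rem <=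
    M * c `^ ((r - 1) / r) * P * Cq `^ (2 - 2 / r) * (D `^ (2 - h) * W `^ h).
  have hh0 : 0 < q `^ q^-1 * r `^ r^-1 * h `^ h by rewrite mulr_gt0// powR_gt0.
  apply: le_trans (ler_wpM2l (ltW hh0) rem) _.
  have K0 : 0 <= M * c `^ ((r - 1) / r) * P.
    by rewrite !mulr_ge0 ?powR_ge0// ltW.
  rewrite [leLHS](_ : _ = M * c `^ ((r - 1) / r) * P *
    (q `^ q^-1 * r `^ r^-1 * h `^ h * B `^ r^-1 * Q `^ (2 - 2 / r))); last by ring.
  rewrite -[leRHS]mulrA ler_wpM2l//.
  apply: (@le_trans _ _ (q `^ q^-1 * r `^ r^-1 * h `^ h * B `^ r^-1 *
    (Cq `^ (2 - 2 / r) * D `^ (2 - 2 * h) * (G ^+ 2) `^ q^-1))).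
    by rewrite ler_wpM2l// !mulr_ge0 ?powR_ge0.
  rewrite -DD [leLHS](_ : _ = Cq `^ (2 - 2 / r) * (D `^ (2 - 2 * h) *
    (q `^ q^-1 * r `^ r^-1 * ((G ^+ 2) `^ q^-1 * B `^ r^-1) * h `^ h))); last by ring.
  by rewrite !ler_wpM2l ?powR_ge0.
(* The negative powers in [eta] become inverses of the powers occurring in [step] and [DW]; all
   powers are then generalized to positive atoms and [field] can compare the constants. *)
have cE : c `^ ((1 - r) / r) = (c `^ ((r - 1) / r))^-1.
  by rewrite -powRN -mulNr opprB.
have CE : Cq `^ ((2 - 2 * r) / r) = (Cq `^ (2 - 2 / r))^-1.
  by rewrite -powRN; congr (_ `^ _); field; rewrite gt_eqF.
have hE2 : h `^ h = h `^ (h / 2) * h `^ (h / 2).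
  by rewrite -powRD ?(gt_eqF rho0) ?implybT//; congr (_ `^ _); field.
have h2E : (2 - h) `^ (h / 2 - 1) = ((2 - h) `^ (1 - h / 2))^-1.
  by rewrite -powRN opprB.
have pc : 0 < c `^ ((r - 1) / r) by rewrite powR_gt0.
have pC : 0 < Cq `^ (2 - 2 / r) by rewrite powR_gt0.
have ph : 0 < h `^ (h / 2) by rewrite powR_gt0.
have pa : 0 < alpha `^ (h / 2) by rewrite powR_gt0.
have p2h : 0 < (2 - h) `^ (1 - h / 2) by rewrite powR_gt0 // subr_gt0.
rewrite cE CE h2E; rewrite hE2 in step.
move: step DW pc pC ph pa p2h.
move: (c `^ _) (Cq `^ _) (h `^ (h / 2)) (alpha `^ _) ((2 - h) `^ _)
  (D `^ _ * W `^ h) => c' C' h' a' h2' Z.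
move=> step DW c'0 C'0 h'0 a'0 h2'0.
rewrite [leLHS](_ : _ = (a' / (C' * M * c' * h' * h2')) *
   (q `^ q^-1 * r `^ r^-1 * (h' * h') * Rem)); last by field; rewrite !gt_eqF.
apply: (@le_trans _ _ ((a' / (C' * M * c' * h' * h2')) * (M * c' * P * C' * Z))).
  by rewrite ler_wpM2l// divr_ge0 ?mulr_ge0// ltW.
rewrite [leLHS](_ : _ = P / (h' * h2') * (Z * a')); last by field; rewrite !gt_eqF.
rewrite [leRHS](_ : _ = P / (h' * h2') * (T * (h2' * h'))); last by field; rewrite !gt_eqF.
by rewrite ler_wpM2l// divr_ge0// mulr_ge0// ltW.
Qed.

End Scalar.

(** * Second order Taylor remainder under the growth condition on phi'' *)

Section Remainder.
Context {R : realType}.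
Implicit Types (phi : R -> R) (r M a b k s : R).

Lemma nondecreasing_derive1_ge0 (f : R -> R) x : derivable f x 1 ->
  {homo f : s t / s <= t} -> 0 <= derive1 f x.
Proof.
move=> df fM; rewrite derive1E; apply: limr_ge; first exact: df.
near=> h.
have h0 : h != 0 by near: h; exact: nbhs_dnbhs_neq.
rewrite /= /GRing.scale/= mulr1.
move: h0; rewrite neq_lt => /orP[h0|h0].
  by rewrite nmulr_rge0 ?invr_lt0// subr_le0 fM// gerDr ltW.
by rewrite pmulr_rge0 ?invr_gt0// subr_ge0 fM// lerDr ltW.
Unshelve. all: by end_near. Qed.

(* Young's inequality with parameter [k] bounds [(b - s) phi''(s)], the derivative
   of [H s = phi s + phi' s (b - s)], by the derivative of an explicit function;
   this replaces the integral form of the remainder. *)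
Lemma taylor_remainder_young phi r M a b k : class_C2 phi ->
  {homo phi : s t / s <= t} -> 1 < r -> 0 < M ->
  (forall s, `|derive1 (derive1 phi) s| <= M * (derive1 phi s) `^ r^-1) ->
  a < b -> 0 < k ->
  `|phi b - phi a - derive1 phi a * (b - a)| <=
  M * (k * ((r - 1) / r) * ((b - a) `^ (r / (r - 1) + 1) * ((r - 1) / (2 * r - 1))) +
       k `^ (1 - r) * r^-1 * (phi b - phi a)).
Proof.
move=> [dphi ddphi _] phiM r1 M0 phi2 ab k0.
have r0 : 0 < r by lra.
have r10 : 0 < r - 1 by lra.
(* [p] is the conjugate exponent of [r]. Integrating (b - s)^p produces 1 / (p + 1) = (r - 1) / (2r
   - 1), the extra factor in [A]. *)
pose p := r / (r - 1).
have p0 : 0 < p by rewrite divr_gt0.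
have pE : p + 1 = (2 * r - 1) / (r - 1) by rewrite /p; field; rewrite !gt_eqF.
have phi'_ge0 s : 0 <= derive1 phi s by exact: nondecreasing_derive1_ge0.
pose A := M * (k * ((r - 1) / r) * ((r - 1) / (2 * r - 1))).
pose B := M * (k `^ (1 - r) * r^-1).
have A0 : 0 <= A by rewrite !mulr_ge0 ?invr_ge0; lra.
have B0 : 0 <= B.
  by rewrite mulr_ge0 ?(ltW M0)// mulr_ge0 ?powR_ge0// invr_ge0 ltW.
(* Young's inequality for k^((r-1)/r) (b - s) and k^((1-r)/r) phi'(s)^(1/r), two factors whose
   powers of [k] cancel. *)
have young s : s < b ->
    `|(derive1 (derive1 phi)) s * (b - s)| <= A * (p + 1) * (b - s) `^ p + B * derive1 phi s.
  move=> sb; have bs0 : 0 < b - s by rewrite subr_gt0.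
  rewrite normrM (gtr0_norm bs0).
  apply: (@le_trans _ _ (M * derive1 phi s `^ r^-1 * (b - s))).
    by rewrite ler_wpM2r// ltW.
  have := @weighted_AMGM R (k * (b - s) `^ p) (k `^ (1 - r) * derive1 phi s) ((r - 1) / r) r^-1.
  rewrite !mulr_ge0 ?powR_ge0 ?(ltW k0)// divr_gt0 ?invr_gt0//.
  have -> : (r - 1) / r + r^-1 = 1 by field; rewrite gt_eqF.
  move=> /(_ isT isT isT r0 erefl).
  rewrite !powRM ?powR_ge0 ?(ltW k0)// -!powRrM.
  have -> : p * ((r - 1) / r) = 1 by rewrite /p; field; rewrite !gt_eqF.
  rewrite powRr1 ?(ltW bs0)// => H.
  have kk : k `^ ((r - 1) / r) * k `^ ((1 - r) * r^-1) = 1.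
    rewrite -powRD ?(gt_eqF k0) ?implybT// -mulrDl.
    by rewrite (_ : r - 1 + (1 - r) = 0) ?mul0r ?powRr0//; ring.
  have -> : M * derive1 phi s `^ r^-1 * (b - s) =
    M * (k `^ ((r - 1) / r) * (b - s) * (k `^ ((1 - r) * r^-1) * (derive1 phi s) `^ r^-1)).
    by rewrite -[LHS]mulr1 -[X in _ * X = _]kk; ring.
  apply: le_trans (ler_wpM2l (ltW M0) H) _.
  rewrite pE /A /B [X in _ <= X](_ : _ = M * ((r - 1) / r *
    (k * (b - s) `^ p) + r^-1 * (k `^ (1 - r) * derive1 phi s)))//.
  by field; rewrite !gt_eqF//; lra.
(* Both signs of the remainder are treated at once; [e] is set to 1 and -1 at the end. *)
have key (e : R) : `|e| <= 1 -> e * (phi b - phi a - derive1 phi a * (b - a)) <=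
    A * (b - a) `^ (p + 1) + B * (phi b - phi a).
  move=> e1.
  pose H := (fun s : R => phi s + derive1 phi s * (b - s)) : R -> R.
  have cH : {for b, continuous H}.
    apply: cvgD.
      exact/differentiable_continuous/derivable1_diffP.
    apply: cvgM; last by apply: cvgB; [exact: cvg_cst|exact: cvg_id].
    exact/differentiable_continuous/derivable1_diffP.
  have Hb : H b = phi b by rewrite /H subrr mulr0 addr0.
  have claim s : a < s -> s < b -> e * (H s - H a) <= A * (b - a) `^ (p + 1) + B * (phi b - phi a).
    move=> as_ sb.
    (* The derivative of [D] is the Young bound minus e H'(s), hence nonnegative, and the mean value
       theorem gives D a <= D s. *)
    pose D := (fun s : R => - A * (b - s) `^ (p + 1) + B * phi s - e * H s) : R -> R.
    have dD t : t < b -> is_derive t 1 D (A * (p + 1) * (b - t) `^ p +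
        B * derive1 phi t - e * (derive1 (derive1 phi) t * (b - t))).
      move=> tb; have bt0 : 0 < b - t by rewrite subr_gt0.
      have lin : is_derive t 1 (fun s : R => b - s) (-1).
        by have := @is_deriveB _ _ _ (cst b) id t 1 0 1 _ _; rewrite sub0r; exact.
      have d1 : is_derive t 1 (fun s : R => (b - s) `^ (p + 1)) ((p + 1) * (b - t) `^ p * -1).
        have := @is_derive1_comp R (fun u : R => u `^ (p + 1))
          (fun s : R => b - s) t _ _ (is_derive1_powR (p + 1) bt0) lin.
        by rewrite addrK.
      have d2 : is_derive t 1 phi (derive1 phi t).
        by rewrite derive1E; apply: DeriveDef.
      have d3 : is_derive t 1 (derive1 phi) (derive1 (derive1 phi) t).
        by rewrite derive1E; apply: DeriveDef.
      have d4 := is_deriveM d3 lin.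
      have d5 := is_deriveB (is_deriveD (is_deriveZ (- A) d1) (is_deriveZ B d2))
        (is_deriveZ e (is_deriveD d2 d4)).
      rewrite (_ : D = - A *: (fun s : R => (b - s) `^ (p + 1)) + B *: phi -
        e *: (phi + derive1 phi * (fun s => b - s))) //.
      apply: is_derive_eq d5 _.
      by rewrite /GRing.scale/=; ring.
    have cD : {within `[a, s], continuous D}.
      apply: continuous_in_subspaceT => t; rewrite inE/= in_itv/= => /andP[_ ts].
      apply/differentiable_continuous/derivable1_diffP.
      by have [] := dD _ (le_lt_trans ts sb).
    have dD' t : t \in `]a, s[%R -> is_derive t 1 D (A * (p + 1) * (b - t) `^ p +
        B * derive1 phi t - e * (derive1 (derive1 phi) t * (b - t))).
      by rewrite in_itv/= => /andP[_ ts]; apply: dD; exact: lt_trans sb.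
    have [c] := MVT as_ dD' cD.
    rewrite in_itv/= => /andP[ac cs] DE.
    have cb := lt_trans cs sb.
    have : 0 <= D s - D a.
      rewrite DE mulr_ge0 ?subr_ge0 ?(ltW as_)//.
      apply: le_trans (young _ cb); apply: le_trans (ler_norm _) _.
      by rewrite normrM ler_piMl.
    rewrite /D => DD.
    have pos : 0 <= A * (b - s) `^ (p + 1) by rewrite mulr_ge0 ?powR_ge0.
    have : B * phi s <= B * phi b.
      by apply: ler_wpM2l => //; apply: phiM; exact: ltW.
    move: DD pos; lra.
  (* The derivative rule for the power is applied at a positive base b - s, so the bound was
     obtained for s < b; continuity of [H] carries it to s = b from the left. *)
  have : e * (H b - H a) <= A * (b - a) `^ (p + 1) + B * (phi b - phi a).
    apply: (@cvgr_to_le _ (b^'-) _ R (fun s => e * (H s - H a))).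
      apply: cvgM; first exact: cvg_cst.
      apply: cvgB; last exact: cvg_cst.
      by apply: cvg_within_filter; exact: cH.
    by near=> s; apply: claim; near: s;
      [apply: nbhs_left_gt|apply: nbhs_left_lt].
  by rewrite Hb /H opprD addrA.
have ABE : A * (b - a) `^ (p + 1) + B * (phi b - phi a) =
    M * (k * ((r - 1) / r) *
      ((b - a) `^ (r / (r - 1) + 1) * ((r - 1) / (2 * r - 1))) +
      k `^ (1 - r) * r^-1 * (phi b - phi a)).
  by rewrite /A /B /p; ring.
rewrite -ABE ler_norml lerNl -[in X in X && _]mulN1r key ?normrN1//=.
by rewrite -[leLHS]mul1r key// normr1.
Unshelve. all: by end_near. Qed.

(** The parametrized bound is optimized over [k]. With X the term of order (b - a)^(p+1) and Y = phi
    b - phi a, the choice k = (Y / X)^(1/r) makes the two terms (r-1)/r k X and 1/r k X, with sum k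
    X = Y^(1/r) X^((r-1)/r). *)
Lemma taylor_remainder_lt phi r M a b : class_C2 phi ->
  {homo phi : s t / s <= t} -> 1 < r -> 0 < M ->
  (forall s, `|derive1 (derive1 phi) s| <= M * (derive1 phi s) `^ r^-1) ->
  a < b ->
  `|phi b - phi a - derive1 phi a * (b - a)| <=
  M * ((r - 1) / (2 * r - 1)) `^ ((r - 1) / r) *
    (`|b - a| `^ (2 - 2 / r) * ((phi b - phi a) * (b - a)) `^ r^-1).
Proof.
move=> C2 phiM r1 M0 phi2 ab.
have r0 : 0 < r by lra.
have r10 : 0 < r - 1 by lra.
have ba0 : 0 < b - a by rewrite subr_gt0.
pose c := (r - 1) / (2 * r - 1).
have c0 : 0 < c by rewrite divr_gt0//; lra.
have H k : 0 < k -> _ := taylor_remainder_young C2 phiM r1 M0 phi2 ab.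
pose X := (b - a) `^ (r / (r - 1) + 1) * c.
have X0 : 0 < X by rewrite mulr_gt0// powR_gt0.
have : 0 <= phi b - phi a by rewrite subr_ge0 phiM// ltW.
rewrite (gtr0_norm ba0) le_eqVlt => /predU1P[Y0|Y0].
  set G := `|_ - _|; rewrite -Y0 mul0r powR0 ?invr_eq0 ?gt_eqF// !mulr0.
  (* For Y = 0 there is no optimal positive [k]: the bound is linear in [k], which is taken
     arbitrarily small. *)
  apply/ler_addgt0Pr => e e0; rewrite add0r.
  have Z0 : 0 < M * ((r - 1) / r * X).
    by apply: mulr_gt0 => //; apply: mulr_gt0 => //; exact: divr_gt0.
  apply: le_trans (H (e / (M * ((r - 1) / r * X))) _) _; first by rewrite divr_gt0.
  rewrite -Y0 mulr0 addr0 -/c -/X.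
  rewrite le_eqVlt; apply/orP; left; apply/eqP; field.
  by rewrite !gt_eqF.
set Y := phi b - phi a in Y0 *.
pose k := (Y / X) `^ r^-1.
have YX0 : 0 < Y / X by rewrite divr_gt0.
have k0 : 0 < k by rewrite powR_gt0.
apply: le_trans (H k k0) _; rewrite -/c -/X -/Y.
have kr : k `^ r = Y / X by rewrite -powRrM mulVf ?gt_eqF// powRr1// ltW.
have -> : k `^ (1 - r) = k * (X / Y).
  by rewrite powRB ?(gt_eqF k0) ?implybT// powRr1 ?(ltW k0)// kr invf_div.
rewrite [X in M * X <= _](_ : _ = k * X); last first.
  by field; rewrite !gt_eqF.
rewrite -mulrA ler_wpM2l ?(ltW M0)//.
rewrite /k powRM ?invr_ge0 ?(ltW X0) ?(ltW Y0)//.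
rewrite -(powR_inv1 (ltW X0)) -powRrM.
rewrite -mulrA -{2}(powRr1 (ltW X0)) -powRD ?(gt_eqF X0) ?implybT//.
rewrite (_ : -1 * r^-1 + 1 = (r - 1) / r); last by field; rewrite gt_eqF.
rewrite /X powRM ?powR_ge0 ?(ltW c0)// powRM ?(ltW Y0) ?(ltW ba0)//.
rewrite -powRrM (_ : (r / (r - 1) + 1) * ((r - 1) / r) = (2 - 2 / r) + r^-1); last first.
  by field; rewrite !gt_eqF.
rewrite powRD ?(gt_eqF ba0) ?implybT// le_eqVlt; apply/orP; left.
by apply/eqP; ring.
Qed.

Lemma derive1_comp_opp (f : R -> R) s : (forall x, derivable f x 1) ->
  derive1 (fun x => f (- x)) s = - derive1 f (- s).
Proof.
move=> df; rewrite !derive1E.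
have d : is_derive (- s) 1 f ('D_1 f (- s)) by exact: DeriveDef.
have := @is_derive1_comp R f -%R s _ _ d (is_deriveNid _ _).
by move=> [_ ->]; rewrite mulrN1.
Qed.

Lemma derivable_comp_opp (f : R -> R) : (forall x, derivable f x 1) ->
  forall s, derivable (fun x => f (- x)) s 1.
Proof.
move=> df s.
have d : is_derive (- s) 1 f ('D_1 f (- s)) by exact: DeriveDef.
by have [] := @is_derive1_comp R f -%R s _ _ d (is_deriveNid _ _).
Qed.

Lemma taylor_remainder phi r M a b : class_C2 phi ->
  {homo phi : s t / s <= t} -> 1 < r -> 0 < M ->
  (forall s, `|derive1 (derive1 phi) s| <= M * (derive1 phi s) `^ r^-1) ->
  `|phi b - phi a - derive1 phi a * (b - a)| <=
  M * ((r - 1) / (2 * r - 1)) `^ ((r - 1) / r) *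
    (`|b - a| `^ (2 - 2 / r) * ((phi b - phi a) * (b - a)) `^ r^-1).
Proof.
move=> C2 phiM r1 M0 phi2.
have [ab|ba|->] := ltgtP a b; first exact: taylor_remainder_lt.
  have [dphi ddphi cphi] := C2.
  (* The case b < a is reduced to the previous one by a point reflection, which preserves
     monotonicity and the growth condition and sends (a, b) to (-a, -b). *)
  pose psi := (fun s => - phi (- s)) : R -> R.
  have dpsi s : derive1 psi s = derive1 phi (- s).
    rewrite derive1E deriveN; last exact: (derivable_comp_opp dphi).
    by rewrite -derive1E (derive1_comp_opp s dphi) opprK.
  have dpsiE : (derive1 psi) = (fun s => derive1 phi (- s)) by apply/funext.
  have ddpsi s : derive1 (derive1 psi) s = - derive1 (derive1 phi) (- s).
    by rewrite dpsiE; exact: (derive1_comp_opp s ddphi).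
  have Cpsi : class_C2 psi.
    split.
    - by move=> s; apply: derivableN; exact: (derivable_comp_opp dphi).
    - by move=> s; rewrite dpsiE; exact: (derivable_comp_opp ddphi).
    - have -> : derive1 (derive1 psi) = fun s => - derive1 (derive1 phi) (- s) by apply/funext.
      move=> s; apply: cvgN.
      by apply: (@cvg_comp _ _ _ -%R); [exact: opp_continuous|exact: cphi].
  have psiM : {homo psi : s t / s <= t}.
    by move=> s t st; rewrite lerN2 phiM// lerN2.
  have psi2 s : `|derive1 (derive1 psi) s| <= M * derive1 psi s `^ r^-1.
    by rewrite ddpsi dpsi normrN.
  have := @taylor_remainder_lt psi r M (- a) (- b) Cpsi psiM r1 M0 psi2.
  rewrite ltrN2 => /(_ ba).
  rewrite /psi dpsi !opprK.
  rewrite (_ : - phi b + phi a - _ = - (phi b - phi a - derive1 phi a * (b - a))); last by ring.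
  rewrite (_ : - b + a = - (b - a)); last by ring.
  rewrite (_ : - phi b + phi a = - (phi b - phi a)); last by ring.
  by rewrite !normrN mulrNN.
rewrite [X in `|X| <= _](_ : _ = 0); last by rewrite !subrr mulr0 subr0.
by rewrite normr0; apply: mulr_ge0; apply: mulr_ge0; rewrite ?powR_ge0 ?(ltW M0).
Qed.
End Remainder.

(** * Null sets and translations *)

Section NullSets.
Local Open Scope ereal_scope.
Context d (T : measurableType d) (R : realType) (mu : {measure set T -> \bar R}).
Import HBNNSimple.

Let ge0_le_integral_off (N : set T) (f g : T -> \bar R) :
  measurable N -> mu N = 0 -> (forall x, 0 <= f x) -> (forall x, 0 <= g x) ->
  (forall x, ~ N x -> f x = g x) -> \int[mu]_x f x <= \int[mu]_x g x.
Proof.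
move=> mN N0 f0 g0 fg.
rewrite [leLHS]ge0_integralTE// [leRHS]ge0_integralTE//.
apply: ge_ereal_sup => _ [h /= hf <-].
apply: ereal_sup_ubound; exists (proj_nnsfun h (measurableC mN)).
  move=> x /=; rewrite mindicE; case: (boolP (x \in ~` N)) => [|_].
    by rewrite inE/= mulr1 => Nx; rewrite -fg.
  by rewrite mulr0.
rewrite -!integralT_nnsfun; apply: ge0_ae_eq_integral => //.
- exact/measurable_EFinP.
- exact/measurable_EFinP.
- by move=> x _; rewrite lee_fin.
- by move=> x _; rewrite lee_fin.
exists N; split => // x /=; apply: contra_notP => Nx _.
by rewrite mindicE mem_set// mulr1.
Qed.

(* No measurability of [f] and [g] is assumed: the integral of a nonnegative
   function is a supremum over simple functions, which may be killed on [N]. *)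
Lemma integral_off_null (D N : set T) (f g : T -> \bar R) :
  measurable N -> mu N = 0 -> (forall x, D x -> ~ N x -> f x = g x) ->
  \int[mu]_(x in D) f x = \int[mu]_(x in D) g x.
Proof.
move=> mN N0 fg; rewrite integral_mkcond [RHS]integral_mkcond.
have {}fg x : ~ N x -> (f \_ D) x = (g \_ D) x.
  by move=> Nx; rewrite !patchE; case: ifPn => //; rewrite inE => /fg; exact.
have gf x : ~ N x -> (g \_ D) x = (f \_ D) x by move/fg.
rewrite integralE [RHS]integralE; congr (_ - _).
  apply/eqP; rewrite eq_le; apply/andP; split;
    apply: (ge0_le_integral_off mN N0) => // x Nx; rewrite !funeposE.
    by rewrite fg.
  by rewrite gf.
apply/eqP; rewrite eq_le; apply/andP; split;
  apply: (ge0_le_integral_off mN N0) => // x Nx; rewrite !funenegE.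
  by rewrite fg.
by rewrite gf.
Qed.

Lemma Rintegral_off_null (D N : set T) (f g : T -> R) :
  measurable N -> mu N = 0 -> (forall x, D x -> ~ N x -> f x = g x) ->
  (\int[mu]_(x in D) f x = \int[mu]_(x in D) g x)%R.
Proof.
move=> mN N0 fg; congr fine; apply: (integral_off_null mN N0) => x Dx Nx.
by rewrite fg.
Qed.
End NullSets.

Section PlaneMeasure.
Context {R : realType}.
Implicit Types (x y : plane R) (f g : plane R -> R) (D : set (plane R)).

(** The measurable sets are generated by rectangles, so an open set has to be exhibited as a
    countable union of them. Squares with rational centre and half-side are used; a half-side below
    e / 2 keeps a square containing x inside the ball of radius e at x. *)
Lemma open_measurable_plane (U : set (plane R)) : open U -> measurable U.
Proof.
move=> oU.
pose box (t : rat * rat * rat) : set (plane R) :=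
  ball (ratr t.1.1 : R) (ratr t.2 : R) `*` ball (ratr t.1.2 : R) (ratr t.2 : R).
rewrite (_ : U = \bigcup_(t in [set t | box t `<=` U]) box t).
  rewrite bigcup_mkcond; apply: countable_bigcupT_measurable => [|t]; first exact: countableP.
  case: ifPn => _ //.
  by apply: measurableX; exact: measurable_ball.
apply/seteqP; split => [x Ux|x [t tU]]; last exact: tU.
have : nbhs x U by exact: open_nbhs_nbhs.
move=> /nbhs_ballP[e /= e0 eU].
have [d] : exists q : rat, (0 : R) < (ratr q : R) < e / 2.
  have e20 : 0 < e / 2 by rewrite divr_gt0.
  by have [q] := rat_in_itvoo e20; rewrite in_itv/=; exists q.
move=> /andP[d0 de].
have approx (s : R) : exists q : rat, ball (ratr q : R) (ratr d) s.
  have : s - ratr d < s + ratr d by rewrite ltrD2l; lra.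
  move=> /rat_in_itvoo[q]; rewrite in_itv/= => /andP[q1 q2]; exists q.
  by rewrite /ball/= ltr_distl; apply/andP; split; lra.
have [p px1] := approx x.1; have [q qx2] := approx x.2.
exists (p, q, d) => //= y [] /= yp yq; apply: eU; split => /=.
  apply: (@le_ball _ _ _ (ratr d + ratr d)); first lra.
  by apply: ball_triangle yp; exact: ball_sym.
apply: (@le_ball _ _ _ (ratr d + ratr d)); first lra.
by apply: ball_triangle yq; exact: ball_sym.
Qed.

Lemma continuous_measurable_plane f : continuous f -> measurable_fun setT f.
Proof.
move=> /continuousP cf; apply: (measurability _ (RGenOpens.measurableE R)).
move=> _ [_ [a [b ->] <-]]; rewrite setTI; apply: open_measurable_plane.
exact/cf/interval_open.
Qed.

(** The pushforward under the translation agrees with Lebesgue measure on half-open intervals, which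
    determine it. The plane version repeats this with measurable rectangles. *)
Lemma lebesgue_measure_translate (h : R) (A : set R) : measurable A ->
  (@lebesgue_measure R) ((fun t => t + h) @^-1` A) = (@lebesgue_measure R) A.
Proof.
move=> mA.
have mt : measurable_fun [set: measurableTypeR R]
    ((fun t => t + h) : measurableTypeR R -> measurableTypeR R).
  exact: measurable_funD.
apply/esym.
apply: (@lebesgue_measure_unique R (pushforward (@lebesgue_measure R)
  ((fun t => t + h) : measurableTypeR R -> measurableTypeR R))) => //.
move=> _ [[a b]] _ <-; rewrite /pushforward/=.
rewrite [X in _ = lebesgue_measure X](_ : _ = `]a - h, b - h]%classic).
  rewrite !lebesgue_measure_itv/= !lte_fin ltrD2r.
  by case: ifPn => // _; rewrite -!EFinB; congr EFin; ring.
by apply/seteqP; split => x /=; rewrite !in_itv/= ltrBlDr lerBrDr.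
Qed.

Lemma measurable_translate (h : plane R) :
  measurable_fun setT (fun x : plane R => x + h).
Proof.
apply/measurable_fun_pairP; split.
  by apply: measurable_funD => //; exact: measurable_fst.
by apply: measurable_funD => //; exact: measurable_snd.
Qed.

Lemma leb2_translate (h : plane R) (A : set (plane R)) : measurable A ->
  leb2 ((fun x => x + h) @^-1` A) = leb2 A.
Proof.
move=> mA; apply/esym.
have mt : measurable_fun [set: measurableTypeR R * measurableTypeR R]
  ((fun x => x + h) : _ -> measurableTypeR R * measurableTypeR R).
  exact: measurable_translate.
apply: (@product_measure_unique _ _ _ _ _ _ _ (pushforward leb2
  ((fun x => x + h) : _ -> measurableTypeR R * measurableTypeR R))) => //.
move=> B C mB mC.
transitivity (leb2 (((fun t => t + h.1) @^-1` B) `*` ((fun t => t + h.2) @^-1` C))).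
  by [].
rewrite [LHS]product_measure1E//.
- by congr (_ * _)%E; exact: lebesgue_measure_translate.
- rewrite -[X in measurable X]setTI.
  exact: (@measurable_funD _ _ _ _ id (cst h.1)).
- rewrite -[X in measurable X]setTI.
  exact: (@measurable_funD _ _ _ _ id (cst h.2)).
Qed.

Definition aff (l : R * R * R) : plane R -> R :=
  fun x => l.1.1 + l.1.2 * x.1 + l.2 * x.2.

Lemma continuous_aff l : continuous (aff l).
Proof.
move=> x; apply: cvgD.
  by apply: cvgD; [exact: cvg_cst|apply: cvgM; [exact: cvg_cst|exact: cvg_fst]].
by apply: cvgM; [exact: cvg_cst|exact: cvg_snd].
Qed.

Definition line l : set (plane R) := [set x | aff l x = 0].

Lemma measurable_line l : measurable (line l).
Proof.
rewrite -[line l]setTI (_ : line l = aff l @^-1` [set 0])//.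
exact: (continuous_measurable_plane (@continuous_aff l)).
Qed.

(** A vertical line is a product with a null factor, and any other line has singleton vertical
    sections. The condition on [l] keeps [line l] from being the whole plane. *)
Lemma leb2_line l : (l.1.2, l.2) != (0, 0) -> leb2 (line l) = 0%E.
Proof.
case: l => [[c a] b] /=; have [->|b0] := eqVneq b 0.
  rewrite xpair_eqE eqxx andbT => a0.
  rewrite (_ : line _ = [set - c / a] `*` [set: R]).
    rewrite [LHS]product_measure1E//.
    transitivity (0 * (@lebesgue_measure R) setT)%E; last by rewrite mul0e.
    by congr (_ * _)%E; exact: lebesgue_measure_set1.
  apply/seteqP; split => -[x y]; rewrite /line/aff/= mul0r addr0.
    move=> /eqP; rewrite addrC addr_eq0 => /eqP H; split => //.
    by rewrite -H mulrC mulKf.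
  by move=> [-> _]; rewrite mulrCA divff// mulr1 subrr.
move=> _; transitivity (\int[@lebesgue_measure R]_x (cst 0%E) x)%E; last first.
  by rewrite integral0.
apply: eq_integral => x _ /=.
rewrite (_ : xsection _ _ = [set - (c + a * x) / b]); first exact: lebesgue_measure_set1.
apply/seteqP; split => y; rewrite /xsection/= inE /line/aff/=.
  by move=> /eqP; rewrite addrC addr_eq0 => /eqP <-; rewrite mulrC mulKf.
by move=> ->; rewrite mulrCA divff// mulr1 subrr.
Qed.

Definition lines (s : seq (R * R * R)) : set (plane R) :=
  \big[setU/set0]_(l <- s) line l.

Lemma measurable_lines s : measurable (lines s).
Proof. by apply: bigsetU_measurable => l _; exact: measurable_line. Qed.

Lemma leb2_lines s : all (fun l => (l.1.2, l.2) != (0, 0)) s ->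
  leb2 (lines s) = 0%E.
Proof.
rewrite /lines; elim: s => [_|l s ih /= /andP[l0 /ih {}ih]].
  by rewrite big_nil measure0.
rewrite big_cons; apply: null_set_setU => //.
- exact: measurable_line.
- exact: measurable_lines.
- exact: leb2_line.
Qed.

Lemma linesP s x : lines s x <-> exists2 l, l \in s & line l x.
Proof.
rewrite /lines -bigcup_seq; split => [[l /= ls lx]|[l ls lx]]; exists l => //.
Qed.

End PlaneMeasure.

(** * Finite element functions *)

Section Lipschitz.
Context {R : realType}.

(** The hypothesis compares nearby points with [t] only, on a neighbourhood that depends on [t]. The
    points up to which the bound from [a] holds have a supremum [c]; the hypothesis at [c], used on
    its left, puts [c] among them, and used on its right contradicts c < b. *)
Lemma pointwise_lipschitz_real (g : R -> R) (L a b : R) :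
  (forall t, \forall s \near t, `|g s - g t| <= L * `|s - t|) ->
  `|g b - g a| <= L * `|b - a|.
Proof.
move=> gL; wlog : a b / a <= b.
  move=> H; have [/H//|/ltW/H] := leP a b.
  by rewrite (distrC (g a)) (distrC a).
move=> ab; rewrite (ger0_norm (_ : 0 <= b - a)) ?subr_ge0//.
pose S := [set t | a <= t <= b /\ `|g t - g a| <= L * (t - a)].
have Sa : S a by split; rewrite ?lexx// !subrr normr0 mulr0.
have ubS : ubound S b by move=> t [/andP[]].
have supS : has_sup S by split; [exists a|exists b].
pose c := sup S.
have ac : a <= c by apply: ub_le_sup Sa; exists b.
have cb : c <= b by apply: ge_sup => //; exists a.
have Sc : S c.
  have [e /= e0 He] : exists2 e : R, 0 < e & forall s, `|c - s| < e -> `|g s - g c| <= L * `|s - c|.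
    by have /nbhs_ballP[e /= e0 He] := gL c; exists e => // s; exact: He.
  have [s [sab sL] cs] := sup_adherent e0 supS.
  have sc : s <= c by apply: ub_le_sup => //; exists b.
  have := He s; rewrite ger0_norm ?subr_ge0// ltrBlDr -ltrBlDl => /(_ cs) gsc.
  split; first by rewrite ac cb.
  have -> : g c - g a = (g s - g a) - (g s - g c) by ring.
  apply: le_trans (ler_normB _ _) _; apply: le_trans (lerD sL gsc) _.
  rewrite distrC ger0_norm ?subr_ge0//; lra.
have [/eqP <-|] := boolP (c == b); first by case: Sc.
rewrite eq_le cb/= -ltNge => {}cb; exfalso.
have [e /= e0 He] : exists2 e : R, 0 < e & forall s, `|c - s| < e -> `|g s - g c| <= L * `|s - c|.
  by have /nbhs_ballP[e /= e0 He] := gL c; exists e => // s; exact: He.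
pose s := c + Num.min (b - c) (e / 2).
have d0 : 0 < Num.min (b - c) (e / 2) by rewrite lt_min subr_gt0 cb divr_gt0.
have cs : c < s by rewrite ltrDl.
have sb : s <= b by rewrite -lerBrDl ge_min lexx.
suff /(ub_le_sup (ex_intro _ b ubS)) : S s by rewrite leNgt cs.
have [_ cL] := Sc.
split; first by rewrite (le_trans ac (ltW cs)).
have : `|c - s| < e.
  rewrite distrC /s addrAC subrr add0r gtr0_norm//.
  by rewrite gt_min; apply/orP; right; rewrite ltr_pdivrMr//; lra.
move=> /He; rewrite (gtr0_norm (_ : 0 < s - c)) ?subr_gt0// => gsc.
have -> : g s - g a = (g s - g c) + (g c - g a) by ring.
apply: le_trans (ler_normD _ _) _; apply: le_trans (lerD gsc cL) _; lra.
Qed.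

(** Restriction to the segment from [x] to [y]. A global Lipschitz constant follows without tracking
    which triangles the segment crosses. *)
Lemma pointwise_lipschitz (f : plane R -> R) (L : R) :
  (forall x, \forall y \near x, `|f y - f x| <= L * `|y - x|) ->
  forall x y, `|f y - f x| <= L * `|y - x|.
Proof.
move=> fL x y; pose p (t : R) := x + t *: (y - x).
have := @pointwise_lipschitz_real (f \o p) (L * `|y - x|) 0 1.
rewrite /= /p scale1r scale0r addr0 subr0 normr1 mulr1.
have -> : x + (y - x) = y by rewrite addrC subrK.
apply => t.
have cp : {for t, continuous p}.
  apply: cvgD; first exact: cvg_cst.
  by apply: cvgZr_tmp; exact: cvg_id.
have H : \forall s \near t, `|f (p s) - f (p t)| <= L * `|p s - p t|.
  exact: (cp _ (fL (p t))).
near=> s; have -> : L * `|y - x| * `|s - t| = L * `|p s - p t|.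
  rewrite /p opprD addrACA subrr add0r -scalerBl normrZ.
  by rewrite [`|s - t| * _]mulrC mulrA.
by near: s.
Unshelve. all: by end_near. Qed.

Lemma lipschitz_continuous (f : plane R -> R) (L : R) : 0 <= L ->
  (forall x y, `|f y - f x| <= L * `|y - x|) -> continuous f.
Proof.
move=> L0 fL x; apply/cvgrPdist_lt => e e0.
near=> y; rewrite distrC; apply: le_lt_trans (fL _ _) _.
apply: (@le_lt_trans _ _ ((L + 1) * `|y - x|)).
  by rewrite ler_wpM2r// lerDl.
rewrite mulrC -ltr_pdivlMr ?ltr_wpDl//.
near: y; apply: cvgr_distC_lt; first exact: cvg_id.
by rewrite divr_gt0// ltr_wpDl.
Unshelve. all: by end_near. Qed.

Lemma aff_lipschitz l (x y : plane R) :
  `|aff l y - aff l x| <= (`|l.1.2| + `|l.2|) * `|y - x|.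
Proof.
rewrite /aff; have -> : l.1.1 + l.1.2 * y.1 + l.2 * y.2 - (l.1.1 + l.1.2 * x.1 + l.2 * x.2) =
  l.1.2 * (y - x).1 + l.2 * (y - x).2 by rewrite /=; ring.
apply: le_trans (ler_normD _ _) _; rewrite mulrDl !normrM.
by apply: lerD; rewrite ler_wpM2l// prod_normE le_max lexx ?orbT.
Qed.

End Lipschitz.

(** * Triangles as intersections of half-planes *)

Section Triangles.
Context {R : realType}.

Lemma big_I3 (V : nmodType) (F : 'I_3 -> V) :
  \sum_k F k = F ord0 + F (inord 1) + F (inord 2).
Proof.
rewrite !big_ord_recl big_ord0 addr0 addrA.
by congr (_ + F _ + F _); apply: val_inj; rewrite /= inordK.
Qed.

Lemma I3P (P : 'I_3 -> Prop) :
  P ord0 -> P (inord 1) -> P (inord 2) -> forall k, P k.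
Proof.
move=> P0 P1 P2 [[|[|[|//]]] hk].
- by rewrite (_ : Ordinal hk = ord0)//; exact: val_inj.
- by rewrite (_ : Ordinal hk = inord 1)//; apply: val_inj; rewrite /= inordK.
- by rewrite (_ : Ordinal hk = inord 2)//; apply: val_inj; rewrite /= inordK.
Qed.

Definition on_I3 T (t0 t1 t2 : T) : 'I_3 -> T :=
  fun k => if val k == 0%N then t0 else if val k == 1%N then t1 else t2.

Lemma on_I3E T (t0 t1 t2 : T) : (on_I3 t0 t1 t2 ord0 = t0) *
  (on_I3 t0 t1 t2 (inord 1) = t1) * (on_I3 t0 t1 t2 (inord 2) = t2).
Proof. by rewrite /on_I3 /= !inordK. Qed.

(* The witnesses are the barycentric coordinates, by Cramer's rule. *)
Lemma triangle_halfplanes (a : 'I_3 -> plane R) : nondegenerate_triangle a ->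
  exists l : 'I_3 -> R * R * R,
    (forall k, ((l k).1.2, (l k).2) != (0, 0)) /\
    triangle a = [set x | forall k, 0 <= aff (l k) x].
Proof.
rewrite /nondegenerate_triangle; set u := a (inord 1) - _; set v := a (inord 2) - _.
have a1 : a (inord 1) = a ord0 + u by rewrite /u addrC subrK.
have a2 : a (inord 2) = a ord0 + v by rewrite /v addrC subrK.
have [b0 a0] : exists p, a ord0 = p by exists (a ord0).
move: a1 a2; rewrite a0; move: u v => u v a1 a2.
set dt := u.1 * v.2 - u.2 * v.1 => dt0.
pose l1 := ((b0.2 * v.1 - b0.1 * v.2) / dt, v.2 / dt, - v.1 / dt).
pose l2 := ((u.2 * b0.1 - u.1 * b0.2) / dt, - u.2 / dt, u.1 / dt).
pose l0 := (1 - l1.1.1 - l2.1.1, - l1.1.2 - l2.1.2, - l1.2 - l2.2).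
exists (on_I3 l0 l1 l2); split.
  have nz p : p / dt = 0 -> p = 0.
    by move=> /eqP; rewrite mulf_eq0 invr_eq0 (negbTE dt0) orbF => /eqP.
  apply: I3P; rewrite !on_I3E; apply: contraNneq dt0 => -[/= h1 h2]; apply/eqP.
  - have /nz /subr0_eq E1 : (u.2 - v.2) / dt = 0. by rewrite -h1; ring.
    have /nz /subr0_eq E2 : (v.1 - u.1) / dt = 0 by rewrite -h2; ring.
    by rewrite /dt E1 E2; ring.
  - by rewrite /dt (nz _ h1) (_ : v.1 = 0); [ring|rewrite -[LHS]opprK (nz _ h2) oppr0].
  - by rewrite /dt (nz _ h2) (_ : u.2 = 0); [ring|rewrite -[LHS]opprK (nz _ h1) oppr0].
apply/seteqP; split => x.
  move=> [m [m0]]; rewrite !big_I3 a1 a2 a0 => m1 ->.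
  have E : m ord0 = 1 - m (inord 1) - m (inord 2) by rewrite -m1; ring.
  apply: I3P; rewrite !on_I3E.
  - rewrite (_ : aff _ _ = m ord0)//.
    by rewrite /dt E /aff /= /GRing.scale/= /dt; field.
  - rewrite (_ : aff _ _ = m (inord 1))//.
    by rewrite /aff /= /GRing.scale/= E /dt; field.
  - rewrite (_ : aff _ _ = m (inord 2))//.
    by rewrite /aff /= /GRing.scale/= E /dt; field.
move=> /= m0; exists (fun k => aff (on_I3 l0 l1 l2 k) x); split => //.
  by rewrite big_I3 !on_I3E /aff/=; ring.
rewrite big_I3 a1 a2 a0 !on_I3E /aff/=.
rewrite [LHS]surjective_pairing; congr pair; rewrite /= /GRing.scale/= /dt; field; exact: dt0.
Qed.
End Triangles.

Section FiniteElements.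
Context {R : realType}.
Variables (Omega : set (plane R)) (n : nat) (Th : 'I_n -> 'I_3 -> plane R).
Hypothesis hOmega : convex_polygonal_domain Omega.
Hypothesis hTh : conforming_triangulation Omega Th.
Implicit Types (f : plane R -> R) (x y : plane R).

Lemma segment_line (p q : plane R) :
  exists l, (l.1.2, l.2) != (0, 0) /\ segment p q `<=` line l.
Proof.
have [->|pq] := eqVneq p q.
  (* A degenerate boundary segment is placed on the vertical line through its single point. *)
  exists (- q.1, 1, 0); split => /=; first by rewrite xpair_eqE oner_eq0.
  by move=> x [t _ ->]; rewrite /line/aff/= /GRing.scale/=; ring.
exists (p.2 * (q.1 - p.1) - p.1 * (q.2 - p.2), q.2 - p.2, - (q.1 - p.1)); split => /=.
  apply: contraNneq pq => -[/subr0_eq h2 /eqP]; rewrite oppr_eq0 => /eqP/subr0_eq h1.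
  by rewrite (surjective_pairing p) (surjective_pairing q) h1 h2.
by move=> x [t _ ->]; rewrite /line/aff/= /GRing.scale/=; ring.
Qed.

Lemma closed_triangle i : closed (triangle (Th i)).
Proof.
have [nd _ _] := hTh; have [l [_ ->]] := triangle_halfplanes (nd i).
rewrite (_ : [set x | _] = \bigcap_(k in setT) (aff (l k) @^-1` [set t | 0 <= t])).
  apply: closed_bigI => k _; apply: closed_comp; last exact: closed_ge.
  by move=> x _; exact: continuous_aff.
by apply/seteqP; split => x /= H => [k _|k]; exact: H.
Qed.

(** The list collects the lines through the triangle sides and the boundary segments. A point of a
    triangle off these lines has positive barycentric coordinates, so the triangle contains a
    neighbourhood of it. *)
Lemma mesh_lines : exists s, all (fun l : R * R * R => (l.1.2, l.2) != (0, 0)) s /\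
  forall x, ~ lines s x ->
    (Omega x /\ exists i, \forall y \near x, triangle (Th i) y) \/
    ~ closure Omega x.
Proof.
have [nd Tcov _] := hTh; have [_ _ _ _ [segs Eseg]] := hOmega.
have /choice[L HL] := fun i => triangle_halfplanes (nd i).
have /choice[S HS] := fun ab : plane R * plane R => segment_line ab.1 ab.2.
exists ([seq L ik.1 ik.2 | ik <- enum {: 'I_n * 'I_3}] ++ map S segs); split.
  rewrite all_cat; apply/andP; split; apply/allP => _ /mapP[z _ ->].
    by have [] := HL z.1.
  by have [] := HS z.
move=> x /linesP xN; have [xO|xO] := pselect (closure Omega x); last by right.
left; split.
  apply: contrapT => nO; apply: xN.
  have : (closure Omega `\` Omega) x by [].
  rewrite Eseg => -[ab /= abs xab]; exists (S ab).
    by rewrite mem_cat map_f ?orbT.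
  by have [_] := HS ab; exact.
move: xO; rewrite -Tcov => -[i _ xi]; exists i.
have [_ Ti] := HL i; move: xi; rewrite Ti /= => xi.
suff H : \forall y \near x, forall k, 0 <= aff (L i k) y by exact: H.
refine (@filter_forall _ _ (fun k (y : plane R) => 0 <= aff (L i k) y) (nbhs x) _ _) => k.
have : 0 < aff (L i k) x.
  rewrite lt_neqAle xi andbT eq_sym; apply/eqP => l0; apply: xN.
  exists (L i k) => //; rewrite mem_cat; apply/orP; left.
  by apply/mapP; exists (i, k) => //; rewrite mem_enum.
move=> /(cvgr_gt _ (@continuous_aff R (L i k) x)); apply: filterS => y.
exact: ltW.
Qed.

Lemma Xh0_out f x : in_Xh0 Omega Th f -> ~ Omega x -> f x = 0.
Proof.
move=> [[_ bd] _ out] nx.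
by have [cx|] := pselect (closure Omega x); [exact: bd|exact: out].
Qed.

(** The finitely many triangles are closed, so for y close to x every triangle containing y also
    contains x, and f y - f x is computed with one affine piece. If y is outside the open set
    [Omega], then so is x, and both values are 0. Summing the slopes of all pieces gives one
    constant. *)
Lemma Xh0_lipschitz f : in_Xh0 Omega Th f ->
  exists2 L, 0 <= L & forall x y, `|f y - f x| <= L * `|y - x|.
Proof.
move=> fX; have [_ faff _] := fX; have [_ Tcov _] := hTh.
have [oO _ _ _ _] := hOmega.
have /choice[l Hl] : forall i, exists l : R * R * R, forall x, triangle (Th i) x -> f x = aff l x.
  by move=> i; have [c [d1 [d2 H]]] := faff i; exists (c, d1, d2).
pose L := \sum_i (`|(l i).1.2| + `|(l i).2|).
have L0 : 0 <= L by apply: sumr_ge0 => i _; exact: addr_ge0.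
exists L => //; apply: pointwise_lipschitz => x.
have nearT : \forall y \near x, forall i, triangle (Th i) y -> triangle (Th i) x.
  refine (@filter_forall _ _ (fun i (y : plane R) =>
    triangle (Th i) y -> triangle (Th i) x) (nbhs x) _ _) => i.
  have [Tx|Tx] := pselect (triangle (Th i) x).
    by near=> y.
  have : \forall y \near x, (~` triangle (Th i)) y.
    by apply: open_nbhs_nbhs; split => //; exact/closed_openC/closed_triangle.
  by apply: filterS => y Ty /Ty.
have nearO : \forall y \near x, ~ Omega y -> ~ Omega x.
  have [Ox|Ox] := pselect (Omega x); last by near=> y.
  have : \forall y \near x, Omega y by apply: open_nbhs_nbhs.
  by apply: filterS => y.
near=> y; have [Oy|Oy] := pselect (Omega y); last first.
  rewrite (Xh0_out fX Oy) (Xh0_out fX); last by apply: (near nearO y).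
  by rewrite subrr normr0 mulr_ge0.
have : closure Omega y by exact: subset_closure.
rewrite -Tcov => -[i _ Ty].
have Tx : triangle (Th i) x by apply: (near nearT y).
rewrite (Hl i)// (Hl i)//; apply: le_trans (aff_lipschitz _ _ _) _.
rewrite ler_wpM2r// /L (bigD1 i)//= lerDl; apply: sumr_ge0 => j _.
exact: addr_ge0.
Unshelve. all: by end_near. Qed.

Lemma Omega_bounded : exists2 B, 0 <= B & forall x, Omega x -> `|x| <= B.
Proof.
have [_ _ [M [_ OM]] _ _] := hOmega.
exists (Num.max (M + 1) 0); first by rewrite le_max lexx orbT.
by move=> x Ox; apply: (OM (Num.max (M + 1) 0)) => //; rewrite lt_max ltrDl ltr01.
Qed.

Lemma Xh0_bounded f : in_Xh0 Omega Th f -> exists B, forall x, `|f x| <= B.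
Proof.
move=> fX; have [L L0 fL] := Xh0_lipschitz fX.
have [B B0 OB] := Omega_bounded.
(* A point outside [Omega], where [f] vanishes; the Lipschitz bound from [z] then controls [f] on
   [Omega]. *)
pose z : plane R := (B + 1, 0).
have zB : `|z| = B + 1.
  rewrite prod_normE/= normr0 ger0_norm; last by rewrite addr_ge0.
  by apply/max_idPl; rewrite addr_ge0.
have Oz : ~ Omega z by move=> /OB; rewrite zB; lra.
exists (L * (B + (B + 1))) => x.
have [Ox|Ox] := pselect (Omega x); last first.
  by rewrite (Xh0_out fX Ox) normr0 mulr_ge0//; lra.
rewrite -[f x]subr0 -(Xh0_out fX Oz); apply: le_trans (fL _ _) _.
rewrite ler_wpM2l//; apply: le_trans (ler_normB _ _) _.
by rewrite zB lerD2r OB.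
Qed.

Lemma Xh0_continuous f : in_Xh0 Omega Th f -> continuous f.
Proof. by move=> /Xh0_lipschitz[L L0 fL]; exact: lipschitz_continuous L0 fL. Qed.

Lemma Xh0B f g : in_Xh0 Omega Th f -> in_Xh0 Omega Th g ->
  in_Xh0 Omega Th (fun x => f x - g x).
Proof.
move=> fX gX; have [_ fa f0] := fX; have [_ ga g0] := gX; split.
- split.
    apply: continuous_subspaceT => x; apply: cvgB; exact: Xh0_continuous.
  by move=> x [_ Ox]; rewrite (Xh0_out fX Ox) (Xh0_out gX Ox) subrr.
- move=> i; have [c [d1 [d2 H]]] := fa i; have [c' [d1' [d2' H']]] := ga i.
  exists (c - c'), (d1 - d1'), (d2 - d2') => x Tx.
  by rewrite (H x Tx) (H' x Tx); ring.
- by move=> x nx; rewrite f0// g0// subrr.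
Qed.

(** The list is chosen before [f], so one null set serves all finite element functions. The clause l
    = 0 outside [Omega] makes their gradients vanish there. *)
Lemma Xh0_locally_affine : exists s,
  all (fun l : R * R * R => (l.1.2, l.2) != (0, 0)) s /\
  forall f, in_Xh0 Omega Th f ->
  forall x, ~ lines s x -> exists l, (~ Omega x -> l = 0) /\ \forall y \near x, f y = aff l y.
Proof.
have [s [s0 sP]] := mesh_lines; exists s; split => // f [_ fa f0] x xs.
have [[Ox [i nT]]|cx] := sP x xs.
  have [c [d1 [d2 H]]] := fa i; exists (c, d1, d2); split => //.
  by apply: filterS nT => y; exact: H.
exists 0; split => //.
have : \forall y \near x, (~` closure Omega) y.
  by apply: open_nbhs_nbhs; split => //; exact/closed_openC/closed_closure.
by apply: filterS => y /f0 ->; rewrite /aff/= !mul0r !addr0.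
Qed.

End FiniteElements.

(** * Weak derivatives *)

Section Derivatives.
Context {R : realType}.
Implicit Types (f g : plane R -> R) (x y e : plane R).

(** Measurability of limits and dominated convergence concern sequences. The steps [h m] may be
    negative, as the backward quotients in [weak_derivative] are. *)
Lemma derive_seq f x e (h : nat -> R) : derivable f x e ->
  (forall m, h m != 0) -> h @ \oo --> 0 ->
  (fun m => (h m)^-1 * (f (x + h m *: e) - f x)) @ \oo --> 'D_e f x.
Proof.
move=> fx h0 hcv.
have hd : h @ \oo --> 0^'.
  move=> A /= dA; have n0 : \forall m \near \oo, h m != 0 by exact: nearW.
  have dA' : \forall m \near \oo, h m != 0 -> A (h m) by exact: (hcv _ dA).
  by rewrite /nbhs/=; apply: filterS2 n0 dA' => m ? ; apply.
have := cvg_comp h _ hd fx.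
apply: cvg_trans; apply: near_eq_cvg; apply: nearW => m /=.
by rewrite [h m *: e + x]addrC.
Qed.

Definition hseq (m : nat) : R := m.+1%:R^-1.

Lemma hseq_gt0 m : 0 < hseq m. Proof. by rewrite invr_gt0. Qed.

Lemma cvg_hseq : hseq @ \oo --> 0.
Proof. exact: cvg_harmonic. Qed.

Lemma locally_affine_derive f x e l : (\forall y \near x, f y = aff l y) ->
  derivable f x e /\ 'D_e f x = l.1.2 * e.1 + l.2 * e.2.
Proof.
move=> fl; have fx : f x = aff l x by exact: nbhs_singleton fl.
have H : (fun h => h^-1 *: (f (h *: e + x) - f x)) @ 0^' --> l.1.2 * e.1 + l.2 * e.2.
  have ce : {for (0 : R), continuous (fun h : R => h *: e + x)}.
    by apply: cvgD; [apply: cvgZr_tmp; exact: cvg_id|exact: cvg_cst].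
  have fl0 : \forall y \near (0 *: e + x), f y = aff l y by rewrite scale0r add0r.
  have n0 : \forall h \near (0 : R), f (h *: e + x) = aff l (h *: e + x).
    exact: (ce _ fl0).
  apply: cvg_near_cst; near=> h.
  have -> : f (h *: e + x) = aff l (h *: e + x) by near: h; exact: nbhs_dnbhs.
  have h0 : h != 0 by near: h; exact: nbhs_dnbhs_neq.
  by rewrite fx /aff/= /GRing.scale/=; field.
split; first by apply/cvg_ex; eexists; exact: H.
exact/cvg_lim.
Unshelve. all: by end_near. Qed.

Lemma is_derive_line f x e t : derivable f (x + t *: e) e ->
  is_derive t 1 (fun s => f (x + s *: e)) ('D_e f (x + t *: e)).
Proof.
move=> fx.
have E : (fun h => h^-1 *: (f (x + (h *: 1 + t) *: e) - f (x + t *: e))) =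
   (fun h => h^-1 *: (f (h *: e + (x + t *: e)) - f (x + t *: e))).
  apply/funext => h; congr (_ *: (f _ - _)).
  have -> : h *: (1 : R) = h by rewrite /GRing.scale/= mulr1.
  by rewrite scalerDl addrCA.
by split; [rewrite /derivable E|rewrite /derive E].
Qed.

Lemma derive_bound_lipschitz f e K : (forall x, derivable f x e) ->
  (forall x, `|'D_e f x| <= K) ->
  forall x h, `|f (x + h *: e) - f x| <= K * `|h|.
Proof.
move=> df dK x h; pose g s := f (x + s *: e).
have dg (t : R) : is_derive t 1 g ('D_e f (x + t *: e)) by exact: is_derive_line.
have cg (t : R) : {for t, continuous g}.
  by apply/differentiable_continuous/derivable1_diffP; have [] := dg t.
have key (a b : R) : a <= b -> `|g b - g a| <= K * `|b - a|.
  move=> ab; have [|c _ ->] := @MVT_segment R g _ a b ab (fun t _ => dg t).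
    exact: continuous_subspaceT.
  by rewrite normrM ler_wpM2r.
have -> : f x = g 0 by rewrite /g scale0r addr0.
suff : `|g h - g 0| <= K * `|h - 0| by rewrite subr0.
have [h0|/ltW h0] := leP 0 h; first exact: key.
by rewrite (distrC (g h)) (distrC h); exact: key.
Qed.
End Derivatives.

(** * Bounded functions with bounded support *)

Section BoundedSupport.
Context {R : realType}.
Implicit Types (f g k : plane R -> R) (x y e h : plane R) (c : R).

(* The same [K] bounds the values and the support. *)
Definition bounded_support k := exists K, forall x,
  `|k x| <= K /\ (K < `|x| -> k x = 0).

Definition box K : set (plane R) := `[- K, K] `*` `[- K, K].

Lemma boxP K x : box K x <-> `|x| <= K.
Proof.
rewrite prod_normE ge_max /box/= !in_itv/= -!ler_norml.
by split => [[-> ->]|/andP].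
Qed.

Lemma measurable_box K : measurable (box K).
Proof. by apply: measurableX; exact: measurable_itv. Qed.

Lemma leb2_box K : (leb2 (box K) < +oo)%E.
Proof.
have m : measurable (`[- K, K]%classic : set (measurableTypeR R)).
  exact: measurable_itv.
have E : leb2 (box K) = (@lebesgue_measure R `[(- K)%R, K]%classic *
    @lebesgue_measure R `[(- K)%R, K]%classic)%E.
  exact: product_measure1E.
have [r rE] : exists r, @lebesgue_measure R `[- K, K]%classic = r%:E.
  rewrite lebesgue_measure_itv/= lte_fin; case: ifPn => _; last by exists 0.
  by exists (K - - K); rewrite EFinB.
by rewrite E rE -EFinM ltry.
Qed.

Lemma bounded_support_integrable k : measurable_fun setT k ->
  bounded_support k -> leb2.-integrable setT (EFin \o k).
Proof.
move=> mk [K kK].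
have : leb2.-integrable (box K) (EFin \o k).
  apply: measurable_bounded_integrable.
  - exact: measurable_box.
  - exact: leb2_box.
  - exact: measurable_funS mk.
  - exists K; split; first exact: num_real.
    by move=> M KM x _; apply: le_trans (ltW KM); have [] := kK x.
move/(@integrable_mkcond _ _ _ leb2 (box K) (EFin \o k) (measurable_box K)).
congr (leb2.-integrable _ _); apply/funext => x; rewrite patchE.
case: ifPn => //; rewrite notin_setE => /boxP /negP; rewrite -ltNge => Kx.
by have [_ /(_ Kx)] := kK x; rewrite /= => ->.
Qed.

Lemma bounded_supportM k g : bounded_support k ->
  (exists K, forall x, `|g x| <= K) -> bounded_support (fun x => k x * g x).
Proof.
move=> [K kK] [L gL]; exists (Num.max K (K * L)) => x; have [k1 k2] := kK x; split.
  by rewrite le_max normrM ler_pM ?orbT.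
by rewrite gt_max => /andP[/k2 -> _]; rewrite mul0r.
Qed.

Lemma bounded_supportZ c k : bounded_support k ->
  bounded_support (fun x => c * k x).
Proof.
move=> [K kK]; exists (Num.max K (`|c| * K)) => x; have [k1 k2] := kK x; split.
  by rewrite le_max normrM ler_wpM2l ?orbT.
by rewrite gt_max => /andP[/k2 -> _]; rewrite mulr0.
Qed.

Lemma bounded_supportD k g : bounded_support k -> bounded_support g ->
  bounded_support (fun x => k x + g x).
Proof.
move=> [K kK] [L gL]; exists (K + L) => x.
have [k1 k2] := kK x; have [g1 g2] := gL x.
have K0 := le_trans (normr_ge0 _) k1; have L0 := le_trans (normr_ge0 _) g1.
split; first exact: le_trans (ler_normD _ _) (lerD k1 g1).
by move=> KL; rewrite k2 ?g2 ?addr0//; apply: le_lt_trans KL; rewrite ?lerDr ?lerDl.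
Qed.

Lemma bounded_support_sqr k : bounded_support k ->
  bounded_support (fun x => k x ^+ 2).
Proof.
move=> bk; rewrite (_ : (fun x => _) = fun x => k x * k x); last first.
  by apply/funext => x; rewrite expr2.
by apply: bounded_supportM => //; have [K kK] := bk; exists K => x; have [] := kK x.
Qed.

Lemma bounded_support_norm k : bounded_support k -> bounded_support (fun x => `|k x|).
Proof.
move=> [K kK]; exists K => x; have [k1 k2] := kK x.
by rewrite normr_id; split => // /k2 ->; rewrite normr0.
Qed.

Lemma bounded_support_shift k h : bounded_support k ->
  bounded_support (fun x => k (x + h)).
Proof.
move=> [K kK]; exists (K + `|h|) => x; have [k1 k2] := kK (x + h); split.
  by apply: le_trans k1 _; rewrite lerDl.
move=> Kx; apply: k2; rewrite -(ltrD2r `|h|); apply: lt_le_trans Kx _.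
by rewrite -{1}[x](addrK h); exact: ler_normB.
Qed.

Lemma integral_translate k h : measurable_fun setT k -> bounded_support k ->
  (\int[leb2]_x (k (x + h))%:E = \int[leb2]_x (k x)%:E)%E.
Proof.
move=> mk bk.
have mt : measurable_fun [set: measurableTypeR R * measurableTypeR R]
  ((fun x => x + h) : _ -> measurableTypeR R * measurableTypeR R).
  exact: measurable_translate.
have mk' : measurable_fun [set: measurableTypeR R * measurableTypeR R] (EFin \o k).
  exact/measurable_EFinP.
have ik : leb2.-integrable ((fun x => x + h) @^-1` setT) ((EFin \o k) \o (fun x => x + h)).
  rewrite preimage_setT; apply: (bounded_support_integrable (k := fun x => k (x + h))).
    by apply: (measurableT_comp mk); exact: measurable_translate.
  exact: bounded_support_shift.
have E := @integral_pushforward _ _ _ _ _ _ mt leb2 setT _ mk' ik measurableT.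
rewrite preimage_setT in E; apply: (etrans (esym E)).
apply: eq_measure_integral => A mA _; exact: leb2_translate.
Qed.

End BoundedSupport.

Section WeakDerivative.
Context {R : realType}.
Implicit Types (f g k psi : plane R -> R) (x y e : plane R) (N : set (plane R)).

Lemma derive_lipschitz_le f L x e : derivable f x e ->
  (forall x y, `|f y - f x| <= L * `|y - x|) -> `|'D_e f x| <= L * `|e|.
Proof.
move=> df fL; have H := derive_seq df (fun m => lt0r_neq0 (hseq_gt0 m)) (@cvg_hseq R).
have {}H := cvg_norm H.
apply: (cvgr_to_le (H _)); apply: nearW => m.
rewrite normrM normfV (gtr0_norm (hseq_gt0 m)) ler_pdivrMl ?hseq_gt0//.
apply: le_trans (fL _ _) _; rewrite addrC addKr normrZ (gtr0_norm (hseq_gt0 m)).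
by rewrite mulrCA.
Qed.

(** Off [N] the derivative is the pointwise limit of difference quotients, each of which is
    measurable. *)
Lemma measurable_derive_off f e N : measurable N -> continuous f ->
  (forall x, ~ N x -> derivable f x e) ->
  measurable_fun setT (('D_e f) \_ (~` N)).
Proof.
move=> mN cf df; apply/(measurable_restrictT _ (measurableC mN)).
apply: (measurable_fun_cvg (h := fun m x => (hseq m)^-1 * (f (x + hseq m *: e) - f x))).
  move=> m; apply: (measurable_funS measurableT) => //.
  apply: measurable_funM => //; apply: measurable_funB.
    apply: (measurableT_comp (continuous_measurable_plane cf)).
    exact: measurable_translate.
  exact: continuous_measurable_plane.
move=> x Nx; apply: derive_seq; [exact: df| |exact: cvg_hseq].
by move=> m; rewrite lt0r_neq0// hseq_gt0.
Qed.

Lemma dominated_convergence_lim d (T : measurableType d) (S : realType)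
    (mu : {measure set T -> \bar S}) (u : (T -> \bar S)^nat) (v w : T -> \bar S) :
  (forall m, measurable_fun setT (u m)) -> measurable_fun setT v ->
  {ae mu, forall x : T, setT x -> u ^~ x @ \oo --> v x} ->
  mu.-integrable setT w ->
  {ae mu, forall (x : T) m, setT x -> (`|u m x| <= w x)%E} ->
  (\int[mu]_x (u m x))%E @[m --> \oo] --> (\int[mu]_x (v x))%E.
Proof.
move=> mu_ mv uv iw uw.
by have [] := dominated_convergence measurableT mu_ mv uv iw uw.
Qed.

(* Translation invariance moves the difference quotients from [psi] to [f]; both
   sides converge by dominated convergence, thanks to the Lipschitz bounds. *)
Lemma weak_derivative f L N psi e K : measurable N -> leb2 N = 0%E ->
  0 <= L -> (forall x y, `|f y - f x| <= L * `|y - x|) -> bounded_support f ->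
  (forall x, ~ N x -> derivable f x e) ->
  continuous psi -> bounded_support psi ->
  (forall x, derivable psi x e) -> (forall x, `|'D_e psi x| <= K) ->
  \int[leb2]_x (f x * 'D_e psi x) =
  - \int[leb2]_x ((('D_e f) \_ (~` N)) x * psi x).
Proof.
move=> mN N0 L0 fL bf df cpsi bpsi dpsi psiK.
have cf := lipschitz_continuous L0 fL.
have mf := continuous_measurable_plane cf.
have mpsi := continuous_measurable_plane cpsi.
have K0 : 0 <= K by apply: le_trans (psiK 0).
have mdpsi : measurable_fun setT ('D_e psi).
  have := @measurable_derive_off psi e set0 measurable0 cpsi (fun x _ => dpsi x).
  rewrite (_ : _ \_ _ = 'D_e psi)//.
  by apply/funext => x; rewrite patchE setC0 in_setT.
have mg := measurable_derive_off mN cf df.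
have bddM k : bounded_support k -> exists C, forall x, `|k x| <= C.
  by move=> [C kC]; exists C => x; have [] := kC x.
(* [F m] carries the forward quotient of [psi], [Q m] the backward quotient of [f]. Expanding both,
   the product [f psi] is common and the other terms are translates of each other, so their
   integrals agree: summation by parts. *)
pose F m x := f x * ((hseq m)^-1 * (psi (x + hseq m *: e) - psi x)).
pose Q m x := (- hseq m)^-1 * (f (x + (- hseq m) *: e) - f x) * - psi x.
have mtr k h : measurable_fun setT k -> measurable_fun setT (fun x => k (x + h)).
  by move=> mk; apply: (measurableT_comp mk); exact: measurable_translate.
have mF m : measurable_fun setT (F m).
  apply: measurable_funM => //; apply: measurable_funM => //.
  by apply: measurable_funB => //; exact: mtr.
have mQ m : measurable_fun setT (Q m).
  apply: measurable_funM; last exact: measurableT_comp.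
  apply: measurable_funM => //.
  by apply: measurable_funB => //; exact: mtr.
have FQ m : (\int[leb2]_x (F m x)%:E = \int[leb2]_x (Q m x)%:E)%E.
  pose k x := (hseq m)^-1 * (f x * psi (x + hseq m *: e)).
  pose p x := (hseq m)^-1 * (f x * psi x).
  have mk : measurable_fun setT k.
    by apply: measurable_funM => //; apply: measurable_funM => //; exact: mtr.
  have mp : measurable_fun setT p.
    by apply: measurable_funM => //; exact: measurable_funM.
  have bk : bounded_support k.
    apply: bounded_supportZ; apply: bounded_supportM => //; apply: bddM.
    exact: bounded_support_shift.
  have bp : bounded_support p.
    by apply: bounded_supportZ; apply: bounded_supportM => //; exact: bddM.
  pose k' x := k (x + - (hseq m *: e)).
  have ip := bounded_support_integrable mp bp.
  transitivity (\int[leb2]_x ((k x)%:E - (p x)%:E))%E.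
    by apply: eq_integral => x _; rewrite -EFinB /F /k /p; congr EFin; ring.
  transitivity (\int[leb2]_x ((k' x)%:E - (p x)%:E))%E; last first.
    apply: eq_integral => x _; rewrite -EFinB /Q /k' /k /p subrK scaleNr invrN.
    by congr EFin; ring.
  rewrite integralB//; last exact: bounded_support_integrable.
  rewrite [RHS]integralB//; last first.
    apply: (@bounded_support_integrable _ k'); first exact: mtr.
    exact: bounded_support_shift.
  by rewrite (integral_translate (- (hseq m *: e)) mk bk).
have HF : (\int[leb2]_x (F m x)%:E)%E @[m --> \oo] --> (\int[leb2]_x (f x * 'D_e psi x)%:E)%E.
  apply: (@dominated_convergence_lim _ _ R leb2 (fun m => EFin \o F m)
    (EFin \o (fun x => f x * 'D_e psi x)) (EFin \o (fun x => K * `|f x|))).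
  - by move=> m; apply/measurable_EFinP; exact: mF.
  - by apply/measurable_EFinP; exact: measurable_funM.
  - apply: aeW => x _; apply: cvg_EFin; first by apply: nearW.
    apply: cvgM; first exact: cvg_cst.
    apply: derive_seq => //; last exact: cvg_hseq.
    by move=> m; rewrite lt0r_neq0// hseq_gt0.
  - apply: bounded_support_integrable.
      by apply: measurable_funM => //; exact: measurableT_comp.
    exact/bounded_supportZ/bounded_support_norm.
  - apply: aeW => x m _; rewrite /= lee_fin /F normrM mulrC ler_wpM2r//.
    rewrite normrM normfV (gtr0_norm (hseq_gt0 m)) ler_pdivrMl ?hseq_gt0//.
    apply: le_trans (derive_bound_lipschitz dpsi psiK _ _) _.
    by rewrite (gtr0_norm (hseq_gt0 m)) mulrC.
pose G x := (('D_e f) \_ (~` N)) x * - psi x.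
have HQ : (\int[leb2]_x (Q m x)%:E)%E @[m --> \oo] --> (\int[leb2]_x (G x)%:E)%E.
  apply: (@dominated_convergence_lim _ _ R leb2 (fun m => EFin \o Q m)
    (EFin \o G) (EFin \o (fun x => (L * `|e|) * `|psi x|))).
  - by move=> m; apply/measurable_EFinP; exact: mQ.
  - apply/measurable_EFinP; apply: measurable_funM => //.
    exact: measurableT_comp.
  - exists N; split => // x /=; apply: contra_notP => Nx _.
    apply: cvg_EFin; first by apply: nearW.
    apply: cvgM; last exact: cvg_cst.
    rewrite patchE mem_set//; apply: derive_seq; first exact: df.
      by move=> m; rewrite oppr_eq0 lt0r_neq0// hseq_gt0.
    by rewrite -oppr0; apply: cvgN; exact: cvg_hseq.
  - apply: bounded_support_integrable.
      by apply: measurable_funM => //; exact: measurableT_comp.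
    exact/bounded_supportZ/bounded_support_norm.
  - apply: aeW => x m _; rewrite /= lee_fin /Q normrM normrN ler_wpM2r//.
    rewrite normrM normfV normrN (gtr0_norm (hseq_gt0 m)) ler_pdivrMl ?hseq_gt0//.
    apply: le_trans (fL _ _) _; rewrite addrC addKr normrZ normrN.
    by rewrite (gtr0_norm (hseq_gt0 m)) mulrCA.
have E : (\int[leb2]_x (f x * 'D_e psi x)%:E = \int[leb2]_x (G x)%:E)%E.
  have EQ : (fun m => \int[leb2]_x (F m x)%:E)%E = (fun m => \int[leb2]_x (Q m x)%:E)%E.
    by apply/funext.
  have HF' : (fun m => \int[leb2]_x (F m x)%:E)%E @ \oo --> (\int[leb2]_x (f x * 'D_e psi x)%:E)%E.
    exact: HF.
  rewrite EQ in HF'; exact: (cvg_unique _ HF' HQ).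
have ig : leb2.-integrable setT (EFin \o (fun x => (('D_e f) \_ (~` N)) x * psi x)).
  apply: bounded_support_integrable; first exact: measurable_funM.
  rewrite (_ : (fun x => _) = fun x => psi x * ('D_e f \_ (~` N)) x); last first.
    by apply/funext => x; rewrite mulrC.
  apply: bounded_supportM => //; exists (L * `|e|) => x; rewrite patchE.
  case: ifPn => [|_]; last by rewrite normr0 mulr_ge0.
  by rewrite inE => Nx; apply: derive_lipschitz_le => //; exact: df.
rewrite /Rintegral E.
transitivity (fine (\int[leb2]_x (- (('D_e f \_ (~` N)) x * psi x)%:E)%E)).
  by congr fine; apply: eq_integral => x _; rewrite -EFinN /G mulrN.
by rewrite (integralN (integrable_add_def measurableT ig)) fineN.
Qed.
End WeakDerivative.

(** * Norms as real integrals, and bounds for test functions *)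

Section Norms.
Context {R : realType}.
Implicit Types (f g k u psi : plane R -> R) (x y e : plane R) (D : set (plane R)).

Lemma Rintegral_support D k : (forall x, ~ D x -> k x = 0) ->
  \int[leb2]_(x in D) k x = \int[leb2]_x k x.
Proof.
move=> k0; rewrite Rintegral_mkcond; congr Rintegral; apply/funext => x.
by rewrite patchE; case: ifPn => //; rewrite notin_setE => /k0.
Qed.

Lemma Lp_normE D (p : R) k : 0 < p ->
  Lp_norm D p k = ((\int[leb2]_(x in D) (`|k x| `^ p)%:E) `^ p^-1)%E.
Proof.
move=> p0; rewrite /Lp_norm unlock [in RHS]integral_mkcond; congr (_ `^ _)%E.
apply: eq_integral => x _; rewrite patchE /= patchE.
case: ifPn => _ //; by rewrite normr0 powR0 ?gt_eqF.
Qed.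

Lemma integral_fin D k : measurable D -> leb2.-integrable D (EFin \o k) ->
  (\int[leb2]_(x in D) (k x)%:E)%E = (\int[leb2]_(x in D) k x)%:E.
Proof.
by move=> mD ik; rewrite /Rintegral fineK//; exact: integrable_fin_num.
Qed.

Lemma Lp_norm_fin D (p : R) k : 0 < p -> measurable D ->
  leb2.-integrable D (EFin \o (fun x => `|k x| `^ p)) ->
  Lp_norm D p k = ((\int[leb2]_(x in D) (`|k x| `^ p)) `^ p^-1)%:E.
Proof.
by move=> p0 mD ik; rewrite Lp_normE// integral_fin// poweR_EFin.
Qed.

Lemma powR2_norm (t : R) : `|t| `^ 2 = t ^+ 2.
Proof. by rewrite powR_mulrn// real_normK// num_real. Qed.

Lemma in_L2_sqr_integrable D u : measurable D -> in_L2 D u ->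
  leb2.-integrable D (EFin \o (fun x => u x ^+ 2)).
Proof.
move=> mD [mu]; rewrite Lp_normE// => /lty_poweRy.
rewrite invr_eq0 pnatr_eq0 => /(_ isT) uoo.
apply/integrableP; split.
  by apply/measurable_EFinP; exact: measurable_funX.
apply: le_lt_trans uoo; rewrite le_eqVlt; apply/orP; left; apply/eqP.
by apply: eq_integral => x _; rewrite /= powR2_norm ger0_norm// sqr_ge0.
Qed.

Lemma Lp_norm2 D u : measurable D ->
  leb2.-integrable D (EFin \o (fun x => u x ^+ 2)) ->
  Lp_norm D 2 u = ((\int[leb2]_(x in D) (u x ^+ 2)) `^ 2^-1)%:E.
Proof.
move=> mD iu; have E : (fun x => `|u x| `^ 2) = (fun x => u x ^+ 2).
  by apply/funext => x; rewrite powR2_norm.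
have iu' : leb2.-integrable D (EFin \o (fun x => `|u x| `^ 2)) by rewrite E.
by rewrite (Lp_norm_fin (ltr0Sn _ 1) mD iu') E.
Qed.

Lemma fine_Lp_norm2 D u : measurable D ->
  leb2.-integrable D (EFin \o (fun x => u x ^+ 2)) ->
  fine (Lp_norm D 2 u) ^+ 2 = \int[leb2]_(x in D) (u x ^+ 2).
Proof.
move=> mD iu; rewrite Lp_norm2//= -powR_mulrn ?powR_ge0//.
rewrite -powRrM mulVf ?pnatr_eq0// powRr1//.
by apply: Rintegral_ge0 => x _; exact: sqr_ge0.
Qed.

Lemma in_L2_bounded_support k : measurable_fun setT k -> bounded_support k ->
  in_L2 setT k.
Proof.
move=> mk bk; split => //; rewrite Lp_norm2// ?ltry//.
by apply: bounded_support_integrable; [exact: measurable_funX|exact: bounded_support_sqr].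
Qed.

Lemma compact_bounded_support psi : continuous psi ->
  compact (closure [set x | psi x != 0]) -> bounded_support psi.
Proof.
move=> cpsi cS.
have [M [_ HM]] := compact_bounded cS.
have ci : compact (psi @` closure [set x | psi x != 0]).
  by apply: continuous_compact => //; exact: continuous_subspaceT.
have [M' [_ HM']] := compact_bounded ci.
(* 0 covers the zeros of [psi], M + 1 the support and M' + 1 the values on it. *)
exists (Num.max 0 (Num.max (M + 1) (M' + 1))) => x.
have [->|x0] := eqVneq (psi x) 0; first by rewrite normr0 le_max lexx.
have Sx : closure [set x | psi x != 0] x by exact: subset_closure.
split.
  rewrite !le_max [X in _ || (_ || X)](_ : _ = true) ?orbT//.
  by apply: (HM' (M' + 1)); [rewrite ltrDl|exists x].
rewrite !gt_max => /and3P[_ Mx _].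
have xM : `|x| <= M + 1 by apply: (HM (M + 1)) => //; rewrite ltrDl.
by rewrite leNgt Mx in xM.
Qed.

Lemma test_function_derive psi (b : bool) : test_function psi ->
  let e := if b then e2 else e1 in
  [/\ continuous psi, bounded_support psi, (forall x, derivable psi x e) &
     exists K, forall x, `|'D_e psi x| <= K].
Proof.
move=> [sm cS] e; have [c0 d1 d2] := sm [::]; have [c1 _ _] := sm [:: b].
split.
- exact: c0.
- exact: compact_bounded_support cS.
- by move=> x; rewrite /e; case: b {c1 e}; [exact: d2|exact: d1].
(* Off the closed support [psi] is locally zero, so its derivative vanishes there and inherits a
   compact support. *)
have [K HK] : bounded_support ('D_e psi).
  apply: compact_bounded_support; first exact: c1.
  apply: (subclosed_compact _ cS); first exact: closed_closure.
  have cl : closed (closure [set x | psi x != 0]) by exact: closed_closure.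
  rewrite [X in _ `<=` X]((closure_id _).1 cl); apply: closureS => x /= dx.
  apply: contrapT => Sx; move/negP: dx; apply.
  have : \forall y \near x, (~` closure [set x | psi x != 0]) y.
    by apply: open_nbhs_nbhs; split => //; exact: closed_openC.
  move=> nx; have : \forall y \near x, psi y = aff 0 y.
    apply: filterS nx => y Sy; rewrite /aff/= !mul0r !addr0.
    by apply: contrapT => /eqP y0; apply: Sy; exact: subset_closure.
  by move=> /(locally_affine_derive e)[_ ->]; rewrite /= !mul0r addr0.
by exists K => x; have [] := HK x.
Qed.

End Norms.

(** * The Gagliardo-Nirenberg inequality for finite element functions *)

Section Sobolev.
Context {R : realType}.
Variables (Omega : set (plane R)) (n : nat) (Th : 'I_n -> 'I_3 -> plane R).
Hypothesis hOmega : convex_polygonal_domain Omega.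
Hypothesis hTh : conforming_triangulation Omega Th.
Implicit Types (f g k : plane R -> R) (x y e : plane R).

Variable s : seq (R * R * R).
Hypothesis s_nondeg : all (fun l : R * R * R => (l.1.2, l.2) != (0, 0)) s.
Hypothesis s_affine : forall f, in_Xh0 Omega Th f -> forall x, ~ lines s x ->
  exists l, (~ Omega x -> l = 0) /\ \forall y \near x, f y = aff l y.

(* The derivative in direction [e], replaced by 0 on the lines of the mesh, where
   ['D_e f] may be a junk value. *)
Definition gr e f : plane R -> R := ('D_e f) \_ (~` lines s).

Let N0 : leb2 (lines s) = 0%E. Proof. exact: leb2_lines. Qed.
Let mN : measurable (lines s). Proof. exact: measurable_lines. Qed.

Lemma measurable_Omega : measurable Omega.
Proof. by have [oO _ _ _ _] := hOmega; exact: open_measurable_plane. Qed.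

Lemma leb2_Omega : (leb2 Omega < +oo)%E.
Proof.
have [B _ OB] := Omega_bounded hOmega; apply: le_lt_trans (leb2_box B).
apply: le_measure; rewrite ?inE; [exact: measurable_Omega|exact: measurable_box|].
by move=> x /OB /boxP.
Qed.

Lemma supported_bounded_support k : (forall x, ~ Omega x -> k x = 0) ->
  (exists K, forall x, `|k x| <= K) -> bounded_support k.
Proof.
move=> k0 [K kK]; have [B B0 OB] := Omega_bounded hOmega.
exists (Num.max K B) => x; split; first by rewrite le_max kK.
rewrite gt_max => /andP[_ Bx]; apply: k0 => /OB; rewrite leNgt Bx //.
Qed.

Lemma Xh0_bounded_support f : in_Xh0 Omega Th f -> bounded_support f.
Proof.
move=> fX; apply: supported_bounded_support; first by move=> x; exact: Xh0_out fX.
exact: (Xh0_bounded hOmega hTh fX).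
Qed.

Lemma Xh0_derivable f e x : in_Xh0 Omega Th f -> ~ lines s x -> derivable f x e.
Proof.
by move=> fX xs; have [l [_ /(locally_affine_derive e)[]]] := s_affine fX xs.
Qed.

Lemma grE e f x : ~ lines s x -> gr e f x = 'D_e f x.
Proof. by move=> xs; rewrite /gr patchE (mem_set (xs : (~` lines s) x)). Qed.

Lemma gr_out e f x : in_Xh0 Omega Th f -> ~ Omega x -> gr e f x = 0.
Proof.
move=> fX Ox; rewrite /gr patchE; case: ifPn => //; rewrite inE => xs.
have [l [/(_ Ox) -> /(locally_affine_derive e)[_ ->]]] := s_affine fX xs.
by rewrite /= !mul0r addr0.
Qed.

Lemma gr_bounded e f : in_Xh0 Omega Th f -> exists K, forall x, `|gr e f x| <= K.
Proof.
move=> fX; have [L L0 fL] := Xh0_lipschitz hOmega hTh fX.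
exists (L * `|e|) => x; rewrite /gr patchE; case: ifPn => [|_].
  by rewrite inE => xs; apply: derive_lipschitz_le => //; exact: Xh0_derivable.
by rewrite normr0 mulr_ge0.
Qed.

Lemma gr_bounded_support e f : in_Xh0 Omega Th f -> bounded_support (gr e f).
Proof.
move=> fX; apply: supported_bounded_support; last exact: gr_bounded.
by move=> x; exact: gr_out.
Qed.

Lemma measurable_Xh0 f : in_Xh0 Omega Th f -> measurable_fun setT f.
Proof.
by move=> fX; apply: continuous_measurable_plane; exact: (Xh0_continuous hOmega hTh fX).
Qed.

Lemma measurable_gr e f : in_Xh0 Omega Th f -> measurable_fun setT (gr e f).
Proof.
move=> fX; apply: measurable_derive_off => //.
  exact: (Xh0_continuous hOmega hTh).
by move=> x xs; exact: Xh0_derivable.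
Qed.

Lemma grB e f g x : in_Xh0 Omega Th f -> in_Xh0 Omega Th g ->
  gr e (fun x => f x - g x) x = gr e f x - gr e g x.
Proof.
move=> fX gX; rewrite /gr !patchE; case: ifPn => [|_]; last by rewrite subr0.
by rewrite inE => xs; rewrite -deriveB//; exact: Xh0_derivable.
Qed.

Lemma Xh0_in_H1 f : in_Xh0 Omega Th f ->
  in_H1_with_grad f (gr e1 f) (gr e2 f).
Proof.
move=> fX; have [L L0 fL] := Xh0_lipschitz hOmega hTh fX.
have bf := Xh0_bounded_support fX.
split.
- exact: in_L2_bounded_support (measurable_Xh0 fX) bf.
- by apply: in_L2_bounded_support; [exact: measurable_gr|exact: gr_bounded_support].
- by apply: in_L2_bounded_support; [exact: measurable_gr|exact: gr_bounded_support].
move=> psi tpsi; split.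
- have [cpsi bpsi dpsi [K psiK]] := test_function_derive false tpsi.
  by apply: (weak_derivative mN N0 L0 fL bf _ cpsi bpsi dpsi psiK) => x; exact: Xh0_derivable.
- have [cpsi bpsi dpsi [K psiK]] := test_function_derive true tpsi.
  by apply: (weak_derivative mN N0 L0 fL bf _ cpsi bpsi dpsi psiK) => x; exact: Xh0_derivable.
Qed.

Lemma bounded_support_powR k (p : R) : 0 < p -> bounded_support k ->
  bounded_support (fun x => `|k x| `^ p).
Proof.
move=> p0 [K kK]; exists (Num.max K (K `^ p)) => x; have [k1 k2] := kK x; split.
  rewrite ger0_norm ?powR_ge0// le_max; apply/orP; right.
  by apply: ge0_ler_powR; rewrite ?nnegrE ?(ltW p0)//; apply: le_trans k1.
by rewrite gt_max => /andP[/k2 -> _]; rewrite normr0 powR0// gt_eqF.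
Qed.

Lemma powR_integrable k (p : R) : 0 < p -> measurable_fun setT k ->
  bounded_support k -> leb2.-integrable setT (EFin \o (fun x => `|k x| `^ p)).
Proof.
move=> p0 mk bk; apply: bounded_support_integrable; last exact: bounded_support_powR.
by apply: (measurableT_comp (measurable_powR p)); exact: measurableT_comp.
Qed.

Lemma Xh0_powR_integrable (p : R) f : 0 < p -> in_Xh0 Omega Th f ->
  leb2.-integrable Omega (EFin \o (fun x => `|f x| `^ p)).
Proof.
move=> p0 fX.
have mO : measurable (Omega : set (measurableTypeR R * measurableTypeR R)).
  exact: measurable_Omega.
apply: (integrableS measurableT mO (@subsetT _ _)).
exact: (powR_integrable p0 (measurable_Xh0 fX) (Xh0_bounded_support fX)).
Qed.

(** Extension by zero turns the integrals over [Omega] into integrals over the plane. Since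
    [gn_optimal] is an infimum, the inequality is used with admissible constants below Cq + ep, and
    the error ep Y Z is kept below an arbitrary [d]; the 1 in the denominator of [ep] covers Y Z =
    0. *)
Lemma Xh0_gagliardo_nirenberg (q Cq : R) f : 2 < q ->
  (gn_optimal q <= Cq%:E)%E -> in_Xh0 Omega Th f ->
  (\int[leb2]_(x in Omega) (`|f x| `^ q)) `^ q^-1 <=
  Cq * ((\int[leb2]_(x in Omega) (f x ^+ 2)) `^ 2^-1) `^ (2 / q) *
    ((\int[leb2]_(x in Omega) (gr e1 f x ^+ 2 + gr e2 f x ^+ 2)) `^ 2^-1) `^ ((q - 2) / q).
Proof.
move=> q2 Copt fX; have q0 : 0 < q by lra.
have mf := measurable_Xh0 fX; have bf := Xh0_bounded_support fX.
have f0 x : ~ Omega x -> f x = 0 by exact: Xh0_out fX.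
rewrite (@Rintegral_support _ Omega (fun x => `|f x| `^ q)); last first.
  by move=> x Ox; rewrite f0// normr0 powR0// gt_eqF.
rewrite (@Rintegral_support _ Omega (fun x => f x ^+ 2)); last first.
  by move=> x Ox; rewrite f0// expr0n.
rewrite (@Rintegral_support _ Omega (fun x => gr e1 f x ^+ 2 + gr e2 f x ^+ 2)); last first.
  by move=> x Ox; rewrite !gr_out// expr0n/= addr0.
set X := (X in X <= _); set Y := (X in Cq * X * _); set Z := (X in Cq * Y * X).
have E1 : Lp_norm setT q f = X%:E.
  exact: (Lp_norm_fin q0 measurableT (powR_integrable q0 mf bf)).
have if2 : leb2.-integrable setT (EFin \o (fun x => f x ^+ 2)).
  by apply: bounded_support_integrable; [exact: measurable_funX|exact: bounded_support_sqr].
have E2 := Lp_norm2 measurableT if2.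
pose k x := Num.sqrt (gr e1 f x ^+ 2 + gr e2 f x ^+ 2).
have kE : (fun x => k x ^+ 2) = (fun x => gr e1 f x ^+ 2 + gr e2 f x ^+ 2).
  by apply/funext => x; rewrite sqr_sqrtr// addr_ge0 ?sqr_ge0.
have ik : leb2.-integrable setT (EFin \o (fun x => k x ^+ 2)).
  rewrite kE; apply: bounded_support_integrable.
    by apply: measurable_funD; apply: measurable_funX; exact: measurable_gr.
  by apply: bounded_supportD; apply: bounded_support_sqr; exact: gr_bounded_support.
have E3 := Lp_norm2 measurableT ik; rewrite kE in E3.
have key C : gagliardo_nirenberg q C -> X <= C * Y * Z.
  move=> /(_ _ _ _ (Xh0_in_H1 fX)).
  by rewrite E1 E2 E3 !poweR_EFin -!EFinM lee_fin.
apply/ler_addgt0Pr => d d0.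
have YZ0 : 0 <= Y * Z by rewrite mulr_ge0 ?powR_ge0.
pose ep := d / (Y * Z + 1).
have ep0 : 0 < ep by rewrite divr_gt0// ltr_wpDl.
have : (gn_optimal q < (Cq + ep)%:E)%E.
  by apply: le_lt_trans Copt _; rewrite lte_fin ltrDl.
move=> /ereal_inf_lt[_ [C [C0 /key HC] <-]]; rewrite lte_fin => CC.
apply: (le_trans HC); rewrite -!mulrA.
apply: (@le_trans _ _ ((Cq + ep) * (Y * Z))); first by rewrite ler_wpM2r// ltW.
rewrite mulrDl lerD2l /ep mulrAC ler_pdivrMr ?ltr_wpDl//.
by rewrite ler_wpM2l ?(ltW d0)// lerDl.
Qed.
End Sobolev.

(** * Integral inequalities *)

Section Hoelder.
Context d (T : measurableType d) (R : realType) (mu : {measure set T -> \bar R}).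

Lemma cvg_powR_at_right (a l : R) : 0 <= a -> 0 <= l ->
  (a + e) `^ l @[e --> 0^'+] --> a `^ l.
Proof.
move=> a0 l0; have [->|ln0] := eqVneq l 0.
  rewrite powRr0; apply: cvg_near_cst; apply: nearW => e; by rewrite powRr0.
have {ln0}l0 : 0 < l by rewrite lt_neqAle eq_sym ln0.
move: a0; rewrite le_eqVlt => /predU1P[<-|a0].
  rewrite powR0 ?gt_eqF//; under eq_fun do rewrite add0r.
  exact: powR_cvg0.
have ca : {for a, continuous (fun t : R => t `^ l)}.
  apply/differentiable_continuous/derivable1_diffP.
  by have [] := is_derive1_powR l a0.
have : (fun e : R => a + e) @ 0^'+ --> a.
  rewrite -[X in _ --> X]addr0; apply: cvgD; first exact: cvg_cst.
  by apply: cvg_at_right_filter; exact: cvg_id.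
by move=> H; apply: (cvg_comp _ _ H ca).
Qed.

(* The integrals are shifted by [e > 0], which makes the normalization in the
   pointwise AM-GM inequality possible, and [e] tends to 0. *)
Lemma hoelder3 (D : set T) (F a b c : T -> R) (l1 l2 l3 : R) :
  measurable D -> 0 < l1 -> 0 < l2 -> 0 <= l3 -> l1 + l2 + l3 = 1 ->
  mu.-integrable D (EFin \o F) -> mu.-integrable D (EFin \o a) ->
  mu.-integrable D (EFin \o b) -> mu.-integrable D (EFin \o c) ->
  (forall x, D x -> [/\ 0 <= a x, 0 <= b x & 0 <= c x]) ->
  (forall x, D x -> F x <= a x `^ l1 * b x `^ l2 * c x `^ l3) ->
  \int[mu]_(x in D) F x <= (\int[mu]_(x in D) a x) `^ l1 *
    (\int[mu]_(x in D) b x) `^ l2 * (\int[mu]_(x in D) c x) `^ l3.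
Proof.
move=> mD l10 l20 l30 lE iF ia ib ic abc0 Fabc.
set A := \int[mu]_(x in D) a x; set B := \int[mu]_(x in D) b x.
set C := \int[mu]_(x in D) c x.
have A0 : 0 <= A by apply: Rintegral_ge0 => x /abc0[].
have B0 : 0 <= B by apply: Rintegral_ge0 => x /abc0[].
have C0 : 0 <= C by apply: Rintegral_ge0 => x /abc0[].
have key e : 0 < e -> \int[mu]_(x in D) F x <= (A + e) `^ l1 * (B + e) `^ l2 * (C + e) `^ l3.
  move=> e0; have Ae : 0 < A + e by rewrite ltr_wpDl.
  have Be : 0 < B + e by rewrite ltr_wpDl.
  have Ce : 0 < C + e by rewrite ltr_wpDl.
  set S := (A + e) `^ l1 * (B + e) `^ l2 * (C + e) `^ l3.
  have S0 : 0 < S by rewrite !mulr_gt0 ?powR_gt0.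
  (* Coefficients of AM-GM applied to a / (A + e), b / (B + e), c / (C + e) and multiplied by [S];
     after integration the sum is at most S (l1 + l2 + l3) = S. *)
  pose ca := S * (l1 / (A + e)); pose cb := S * (l2 / (B + e)); pose cc := S * (l3 / (C + e)).
  have iZ k (t : R) : mu.-integrable D (EFin \o k) -> mu.-integrable D (EFin \o (fun x => t * k x)).
    exact: integrableZl.
  have iD k k' : mu.-integrable D (EFin \o k) ->
      mu.-integrable D (EFin \o k') ->
      mu.-integrable D (EFin \o (fun x => k x + k' x)).
    exact: integrableD.
  apply: (@le_trans _ _ (\int[mu]_(x in D) (ca * a x + cb * b x + cc * c x))).
    apply: le_Rintegral => //; first by apply: (iD _ _ (iD _ _ _ _)); exact: iZ.
    move=> x Dx; have [ax bx cx] := abc0 x Dx; apply: le_trans (Fabc x Dx) _.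
    have := @weighted_AMGM3 R (a x / (A + e)) (b x / (B + e)) (c x / (C + e)) l1 l2 l3.
    move=> /(_ (divr_ge0 ax (ltW Ae)) (divr_ge0 bx (ltW Be)) (divr_ge0 cx (ltW Ce)) l10 l20 l30 lE).
    move=> /(ler_wpM2l (ltW S0)).
    rewrite [leRHS](_ : _ = ca * a x + cb * b x + cc * c x); last by rewrite /ca /cb /cc; ring.
    apply: le_trans; rewrite le_eqVlt; apply/orP; left; apply/eqP.
    rewrite -{1}(divfK (lt0r_neq0 Ae) (a x)) -{1}(divfK (lt0r_neq0 Be) (b x)).
    rewrite -{1}(divfK (lt0r_neq0 Ce) (c x)).
    rewrite (powRM _ (divr_ge0 ax (ltW Ae)) (ltW Ae)).
    rewrite (powRM _ (divr_ge0 bx (ltW Be)) (ltW Be)).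
    rewrite (powRM _ (divr_ge0 cx (ltW Ce)) (ltW Ce)).
    have regroup (t1 t2 t3 t4 t5 t6 : R) :
      t1 * t2 * (t3 * t4) * (t5 * t6) = t2 * t4 * t6 * (t1 * t3 * t5) by ring.
    exact: regroup.
  rewrite RintegralD//; [|by apply: (iD _ _); exact: iZ|exact: iZ].
  rewrite RintegralD//; [|exact: iZ..].
  rewrite !RintegralZl// -/A -/B -/C.
  rewrite [leLHS](_ : _ = S * (l1 * (A / (A + e)) + l2 * (B / (B + e)) +
    l3 * (C / (C + e)))); last first.
    by rewrite /ca /cb /cc; ring.
  rewrite -[leRHS]mulr1 ler_wpM2l ?(ltW S0)// -lE.
  have le1 t : 0 <= t -> t / (t + e) <= 1.
    by move=> t0; rewrite ler_pdivrMr ?ltr_wpDl// mul1r lerDl ltW.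
  have := ler_wpM2l (ltW l10) (le1 _ A0); have := ler_wpM2l (ltW l20) (le1 _ B0).
  have := ler_wpM2l l30 (le1 _ C0); lra.
apply: (@cvgr_to_ge _ (0^'+ : set_system R) _ R
  (fun e => (A + e) `^ l1 * (B + e) `^ l2 * (C + e) `^ l3)).
  by apply: cvgM; [apply: cvgM|]; apply: cvg_powR_at_right => //; exact: ltW.
by near=> e; apply: key; near: e; exact: nbhs_right_gt.
Unshelve. all: by end_near. Qed.
End Hoelder.

(** * The inner product of square integrable functions *)

Section SquareIntegrable.
Context d (T : measurableType d) (R : realType) (mu : {measure set T -> \bar R}).
Variables (D : set T) (mD : measurable D).
Implicit Types (a b c k : T -> R).

Definition sq_int k := measurable_fun D k /\
  mu.-integrable D (EFin \o (fun x => k x ^+ 2)).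

Definition ip a b := \int[mu]_(x in D) (a x * b x).

Lemma sq_int_mul a b : sq_int a -> sq_int b ->
  mu.-integrable D (EFin \o (fun x => a x * b x)).
Proof.
move=> [ma ia] [mb ib].
apply: (@le_integrable _ _ _ mu D mD _ (EFin \o (fun x => a x ^+ 2 + b x ^+ 2))).
- by apply/measurable_EFinP; exact: measurable_funM.
- move=> x Dx; rewrite /= lee_fin; apply: le_trans (ler_norm _).
  rewrite ler_norml; apply/andP; split.
    have := sqr_ge0 (a x + b x); have := sqr_ge0 (a x); have := sqr_ge0 (b x); nra.
  have := sqr_ge0 (a x - b x); have := sqr_ge0 (a x); have := sqr_ge0 (b x); nra.
- exact: (integrableD mD ia ib).
Qed.

Lemma sq_intZ t k : sq_int k -> sq_int (fun x => t * k x).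
Proof.
move=> [mk ik]; split; first exact: measurable_funM.
rewrite (_ : (fun x => _) = fun x => t ^+ 2 * k x ^+ 2); first exact: (integrableZl mD (t ^+ 2) ik).
by apply/funext => x; rewrite exprMn.
Qed.

Lemma sq_intD a b : sq_int a -> sq_int b -> sq_int (fun x => a x + b x).
Proof.
move=> la lb; have [ma ia] := la; have [mb ib] := lb.
split; first exact: measurable_funD.
have iab : mu.-integrable D (EFin \o (fun x => 2 * (a x * b x))).
  exact: (integrableZl mD 2 (sq_int_mul la lb)).
have i1 : mu.-integrable D (EFin \o (fun x => a x ^+ 2 + 2 * (a x * b x))).
  exact: (integrableD mD ia iab).
have i2 : mu.-integrable D (EFin \o (fun x => a x ^+ 2 + 2 * (a x * b x) + b x ^+ 2)).
  exact: (integrableD mD i1 ib).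
rewrite (_ : (fun x => (a x + b x) ^+ 2) = fun x => a x ^+ 2 + 2 * (a x * b x) + b x ^+ 2)//.
by apply/funext => x; ring.
Qed.

Lemma sq_intB a b : sq_int a -> sq_int b -> sq_int (fun x => a x - b x).
Proof.
move=> la lb; rewrite (_ : (fun x => _) = fun x => a x + -1 * b x).
  by apply: sq_intD => //; exact: sq_intZ.
by apply/funext => x; rewrite mulN1r.
Qed.

Lemma ipC a b : ip a b = ip b a.
Proof. by apply: eq_Rintegral => x _; rewrite mulrC. Qed.

Lemma ipD a b c : sq_int a -> sq_int b -> sq_int c ->
  ip (fun x => a x + b x) c = ip a c + ip b c.
Proof.
move=> la lb lc; rewrite /ip -RintegralD//; [|exact: sq_int_mul..].
by apply: eq_Rintegral => x _; rewrite mulrDl.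
Qed.

Lemma ipB a b c : sq_int a -> sq_int b -> sq_int c ->
  ip (fun x => a x - b x) c = ip a c - ip b c.
Proof.
move=> la lb lc; rewrite /ip -RintegralB//; [|exact: sq_int_mul..].
by apply: eq_Rintegral => x _; rewrite mulrBl.
Qed.

Lemma ipZ t a c : sq_int a -> sq_int c -> ip (fun x => t * a x) c = t * ip a c.
Proof.
move=> la lc; rewrite /ip -RintegralZl//; last exact: sq_int_mul.
by apply: eq_Rintegral => x _; rewrite mulrA.
Qed.

Lemma ip_ge0 a : 0 <= ip a a.
Proof. by apply: Rintegral_ge0 => x _; rewrite -expr2 sqr_ge0. Qed.

Lemma cauchy_schwarz a b : sq_int a -> sq_int b ->
  ip a b <= (ip a a) `^ 2^-1 * (ip b b) `^ 2^-1.
Proof.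
move=> la lb; have [_ ia] := la; have [_ ib] := lb.
(* The third factor is a placeholder with weight 0, whose power is 1 even at 0. *)
have := @hoelder3 _ _ _ mu D (fun x => a x * b x) (fun x => a x ^+ 2)
  (fun x => b x ^+ 2) (fun x => b x ^+ 2) 2^-1 2^-1 0 mD.
rewrite !invr_gt0 !ltr0Sn lexx addr0 => /(_ isT isT isT).
have -> : 2^-1 + 2^-1 = 1 :> R by field.
move=> /(_ erefl (sq_int_mul la lb) ia ib ib).
rewrite powRr0 mulr1; apply.
  by move=> x _; rewrite !sqr_ge0.
move=> x _; rewrite powRr0 mulr1 !powR12_sqrt ?sqr_ge0// !sqrtr_sqr -normrM.
exact: ler_norm.
Qed.

Lemma ip_eq0 a : sq_int a -> ip a a <= 0 -> {ae mu, forall x, D x -> a x = 0}.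
Proof.
move=> [ma ia] a0; have : \int[mu]_(x in D) (a x ^+ 2) = 0.
  by apply/eqP; rewrite eq_le a0 ip_ge0.
move=> H; have {}H : (\int[mu]_(x in D) `|(a x ^+ 2)%:E| = 0)%E.
  under eq_integral do rewrite gee0_abs ?lee_fin ?sqr_ge0//.
  have fin : (\int[mu]_(x in D) (a x ^+ 2)%:E)%E \is a fin_num by exact: integrable_fin_num.
  by rewrite -(fineK fin); congr EFin.
have mf : measurable_fun D (fun x => (a x ^+ 2)%:E).
  by apply/measurable_EFinP; exact: measurable_funX.
have := (ae_eq_integral_abs mu mD mf).1 H.
apply: filterS => x /= H' Dx; have := H' Dx => /= -[] /eqP.
by rewrite sqrf_eq0 => /eqP.
Qed.
End SquareIntegrable.

(** * The discrete control problem *)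

Section Estimate.
Context {R : realType}.
Variables (Omega : set (plane R)) (n : nat) (Th : 'I_n -> 'I_3 -> plane R).
Hypothesis hOmega : convex_polygonal_domain Omega.
Hypothesis hTh : conforming_triangulation Omega Th.
Variable s : seq (R * R * R).
Hypothesis s_nondeg : all (fun l : R * R * R => (l.1.2, l.2) != (0, 0)) s.
Hypothesis s_affine : forall f, in_Xh0 Omega Th f -> forall x, ~ lines s x ->
  exists l, (~ Omega x -> l = 0) /\ \forall y \near x, f y = aff l y.
Variables (phi : R -> R) (r M Cq : R).
Hypothesis hphi : class_C2 phi.
Hypothesis hphi_mono : {homo phi : s t / s <= t}.
Hypothesis hr : 1 < r.
Hypothesis hM : 0 < M.
Hypothesis hphi2 :
  forall s, `|derive1 (derive1 phi) s| <= M * (derive1 phi s) `^ r^-1.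
Hypothesis hCq : 0 < Cq.
Hypothesis hCq_opt : (gn_optimal (qexp r) <= Cq%:E)%E.

Local Notation Xh0 := (in_Xh0 Omega Th).
Local Notation sqi := (sq_int leb2 Omega).
Local Notation "'<| a , b |>" := (ip leb2 Omega a b).
Local Notation g1 := (gr s e1).
Local Notation g2 := (gr s e2).
Let mO : measurable (Omega : set (measurableTypeR R * measurableTypeR R)) :=
  measurable_Omega hOmega.

Lemma in_L2_sq_int (k : plane R -> R) : in_L2 Omega k -> sqi k.
Proof. by move=> lk; split; [case: lk|exact: in_L2_sqr_integrable]. Qed.

Lemma bounded_sq_int (k : plane R -> R) (K : R) : measurable_fun setT k ->
  (forall x, Omega x -> `|k x| <= K) -> sqi k.
Proof.
move=> mk kK; have mk' : measurable_fun Omega k by exact: measurable_funS mk.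
split => //; apply: measurable_bounded_integrable => //.
- exact: leb2_Omega.
- exact: measurable_funX.
exists (K ^+ 2); split; first exact: num_real.
move=> t Kt x Ox; apply: le_trans (ltW Kt).
by rewrite normrX lerXn2r ?nnegrE// ?kK//; apply: le_trans (kK _ Ox).
Qed.

Lemma Xh0_sq_int f : Xh0 f -> sqi f.
Proof.
move=> fX; have [K fK] := Xh0_bounded hOmega hTh fX.
exact: (bounded_sq_int (measurable_Xh0 hOmega hTh fX) (fun x _ => fK x)).
Qed.

Lemma gr_sq_int e f : Xh0 f -> sqi (gr s e f).
Proof.
move=> fX; have [K fK] := gr_bounded hOmega hTh s_affine e fX.
exact: (bounded_sq_int (measurable_gr hOmega hTh s_affine e fX) (fun x _ => fK x)).
Qed.

Lemma continuous_bounded_segment (g : R -> R) B : continuous g ->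
  exists K, forall t, `|t| <= B -> `|g t| <= K.
Proof.
move=> cg; have : compact (g @` `[- B, B]).
  by apply: continuous_compact; [exact: continuous_subspaceT|exact: segment_compact].
move=> /compact_bounded[K [_ HK]]; exists (K + 1) => t tB.
by apply: (HK (K + 1)); [rewrite ltrDl|exists t => //=; rewrite in_itv/= -ler_norml].
Qed.

Lemma comp_measurable (g : R -> R) f : continuous g -> Xh0 f ->
  measurable_fun setT (fun x => g (f x)).
Proof.
move=> cg fX; apply: continuous_measurable_plane => x.
exact: (continuous_comp (@Xh0_continuous _ _ _ _ hOmega hTh f fX x) (cg (f x))).
Qed.

Lemma comp_sq_int (g : R -> R) f : continuous g -> Xh0 f ->
  sqi (fun x => g (f x)) /\ (exists K, forall x, `|g (f x)| <= K).
Proof.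
move=> cg fX; have [B fB] := Xh0_bounded hOmega hTh fX.
have [K gK] := continuous_bounded_segment B cg.
have mgf := comp_measurable cg fX.
by split; [apply: (bounded_sq_int mgf (K := K)) => x _|exists K => x]; exact/gK/fB.
Qed.

Let cphi : continuous phi.
Proof.
by have [d _ _] := hphi; move=> t; apply/differentiable_continuous/derivable1_diffP.
Qed.

Let cphi' : continuous (derive1 phi).
Proof.
by have [_ d _] := hphi; move=> t; apply/differentiable_continuous/derivable1_diffP.
Qed.

Lemma phi_sq_int f : Xh0 f -> sqi (fun x => phi (f x)).
Proof. by move=> /(comp_sq_int cphi)[]. Qed.

Lemma phi'_mul_sq_int f p : Xh0 f -> Xh0 p -> sqi (fun x => derive1 phi (f x) * p x).
Proof.
move=> fX pX; have [_ [K fK]] := comp_sq_int cphi' fX.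
have [L pL] := Xh0_bounded hOmega hTh pX.
apply: (@bounded_sq_int _ (K * L)).
  apply: measurable_funM; last exact: (measurable_Xh0 hOmega hTh pX).
  exact: comp_measurable cphi' fX.
by move=> x _; rewrite normrM ler_pM.
Qed.

(** [grad_dot] has junk values on the mesh lines; replacing it by the products of [gr] changes the
    integrand on a null set only and gives summands whose integrability is known. *)
Lemma grad_ip (y v k : plane R -> R) : Xh0 y -> Xh0 v -> sqi k ->
  \int[leb2]_(x in Omega) (grad_dot y v x + k x * v x) =
  '<| g1 y, g1 v |> + '<| g2 y, g2 v |> + '<| k, v |>.
Proof.
move=> yX vX lk.
rewrite (@Rintegral_off_null _ _ R leb2 Omega (lines s) _
  (fun x => g1 y x * g1 v x + g2 y x * g2 v x + k x * v x)
  (measurable_lines s) (leb2_lines s_nondeg)); last first.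
  by move=> x _ xs; rewrite /grad_dot !grE.
have i1 := sq_int_mul mO (gr_sq_int e1 yX) (gr_sq_int e1 vX).
have i2 := sq_int_mul mO (gr_sq_int e2 yX) (gr_sq_int e2 vX).
have i3 := sq_int_mul mO lk (Xh0_sq_int vX).
rewrite RintegralD//; last exact: (integrableD mO i1 i2).
by rewrite (RintegralD mO i1 i2).
Qed.

Lemma gr_subE e y1 y2 : Xh0 y1 -> Xh0 y2 ->
  gr s e (fun x => y1 x - y2 x) = fun x => gr s e y1 x - gr s e y2 x.
Proof. by move=> X1 X2; apply/funext => x; exact: (grB s_affine). Qed.

Lemma state_sub y1 y2 u1 u2 v : Xh0 y1 -> Xh0 y2 -> Xh0 v ->
  in_L2 Omega u1 -> in_L2 Omega u2 ->
  solves_state Omega Th phi u1 y1 -> solves_state Omega Th phi u2 y2 ->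
  '<| g1 (fun x => y1 x - y2 x), g1 v |> +
  '<| g2 (fun x => y1 x - y2 x), g2 v |> +
  '<| fun x => phi (y1 x) - phi (y2 x), v |> = '<| fun x => u1 x - u2 x, v |>.
Proof.
move=> X1 X2 Xv /in_L2_sq_int l1 /in_L2_sq_int l2 S1 S2.
have E y u : Xh0 y -> solves_state Omega Th phi u y ->
    '<| g1 y, g1 v |> + '<| g2 y, g2 v |> + '<| fun x => phi (y x), v |> = '<| u, v |>.
  by move=> Xy Sy; rewrite -(grad_ip Xy Xv (phi_sq_int Xy)); exact: Sy.
have lv := Xh0_sq_int Xv.
rewrite !gr_subE// (ipB mO (gr_sq_int e1 X1) (gr_sq_int e1 X2) (gr_sq_int e1 Xv)).
rewrite (ipB mO (gr_sq_int e2 X1) (gr_sq_int e2 X2) (gr_sq_int e2 Xv)).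
rewrite (ipB mO (phi_sq_int X1) (phi_sq_int X2) lv) (ipB mO l1 l2 lv).
rewrite -(E _ _ X1 S1) -(E _ _ X2 S2).
have add3B (a b c a' b' c' : R) : a - a' + (b - b') + (c - c') = a + b + c - (a' + b' + c') by ring.
exact: add3B.
Qed.

Lemma sqrt_sqr (t : R) : 0 <= t -> (t `^ 2^-1) ^+ 2 = t.
Proof.
move=> t0; rewrite -powR_mulrn ?powR_ge0// -powRrM mulVf ?pnatr_eq0//.
exact: powRr1.
Qed.

Lemma energy_le (y1 y2 u1 u2 dl w : plane R -> R) :
  dl = (fun x => y1 x - y2 x) -> w = (fun x => u1 x - u2 x) -> Xh0 y1 -> Xh0 y2 ->
  in_L2 Omega u1 -> in_L2 Omega u2 ->
  solves_state Omega Th phi u1 y1 -> solves_state Omega Th phi u2 y2 ->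
  ((\int[leb2]_(x in Omega) (g1 dl x ^+ 2 + g2 dl x ^+ 2)) `^ 2^-1) ^+ 2 +
  '<| fun x => phi (y1 x) - phi (y2 x), dl |> <=
  '<| w, w |> `^ 2^-1 * '<| dl, dl |> `^ 2^-1.
Proof.
move=> dlE wE X1 X2 l1 l2 S1 S2.
have Xd : Xh0 dl by rewrite dlE; exact: Xh0B.
have lw : sqi w by rewrite wE; apply: sq_intB => //; exact: in_L2_sq_int.
apply: le_trans (cauchy_schwarz mO lw (Xh0_sq_int Xd)).
rewrite wE -(state_sub X1 X2 Xd l1 l2 S1 S2) -dlE lerD2r sqrt_sqr.
  have [_ i1] := gr_sq_int e1 Xd; have [_ i2] := gr_sq_int e2 Xd.
  by rewrite (RintegralD mO i1 i2).
by apply: Rintegral_ge0 => x _; rewrite addr_ge0 ?sqr_ge0.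
Qed.

(** By continuity, a point of [Omega] where [f] is nonzero has a square around it inside the
    exceptional set, and a square has positive measure. *)
Lemma Xh0_ae_eq0 f : Xh0 f ->
  {ae leb2, forall x, Omega x -> f x = 0} -> forall x, f x = 0.
Proof.
move=> fX [N [mN N0 NP]] x.
have [Ox|Ox] := pselect (Omega x); last exact: (Xh0_out fX).
have [//|fx] := eqVneq (f x) 0; exfalso.
have [oO _ _ _ _] := hOmega.
have cf := Xh0_continuous hOmega hTh fX.
have n1 : \forall y \near x, Omega y by apply: open_nbhs_nbhs.
have n2 : \forall y \near x, f y != 0.
  have : \forall t \near f x, t != 0.
    by apply: open_nbhs_nbhs; split => //; apply: open_neq.
  exact: (cf x).
have /nbhs_ballP[e /= e0 eP] : \forall y \near x, Omega y /\ f y != 0.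
  by apply: filterS2 n1 n2.
have sub : ball x.1 e `*` ball x.2 e `<=` N.
  move=> y yb; apply: NP => /= H; have [Oy] : Omega y /\ f y != 0 by apply: eP.
  by rewrite (H Oy) eqxx.
have m1 (t : R) : @measurable _ (measurableTypeR R) (ball t e) by exact: measurable_ball.
have : (leb2 (ball x.1 e `*` ball x.2 e) <= leb2 N)%E.
  by apply: le_measure; rewrite ?inE//; exact: measurableX.
rewrite N0; apply/negP; rewrite -ltNge.
have -> : leb2 (ball x.1 e `*` ball x.2 e) = ((e *+ 2)%:E * (e *+ 2)%:E)%E.
  transitivity (@lebesgue_measure R (ball x.1 e) * @lebesgue_measure R (ball x.2 e))%E.
    exact: product_measure1E.
  by rewrite !lebesgue_measure_ball// ltW.
by rewrite -EFinM lte_fin mulr_gt0// mulrn_wgt0.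
Qed.

Lemma mono_sub_mul_ge0 a b : 0 <= (phi a - phi b) * (a - b).
Proof.
have [ab|/ltW ba] := leP b a.
  by rewrite mulr_ge0 ?subr_ge0 ?hphi_mono.
by rewrite mulr_le0 ?subr_le0 ?hphi_mono.
Qed.

Lemma mono_ip_ge0 y1 y2 :
  0 <= '<| fun x => phi (y1 x) - phi (y2 x), fun x => y1 x - y2 x |>.
Proof. by apply: Rintegral_ge0 => x _; exact: mono_sub_mul_ge0. Qed.

(** With equal controls the energy estimate makes the gradient of the difference vanish.
    Gagliardo-Nirenberg then takes the place of the Poincare inequality: the L^q norm of the
    difference vanishes as well. *)
Lemma state_unique u y1 y2 : in_L2 Omega u -> Xh0 y1 -> Xh0 y2 ->
  solves_state Omega Th phi u y1 -> solves_state Omega Th phi u y2 ->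
  y1 = y2.
Proof.
move=> lu X1 X2 S1 S2.
pose dl x := y1 x - y2 x; pose w x := u x - u x.
have Xd : Xh0 dl by exact: (Xh0B hOmega hTh).
have q2 := qexp_gt2 hr; have q0 : 0 < qexp r by lra.
have := @energy_le y1 y2 u u dl w erefl erefl X1 X2 lu lu S1 S2.
have -> : '<| w, w |> = 0.
  transitivity (\int[leb2]_(x in Omega) (0 : R)).
    by apply: eq_Rintegral => x _; rewrite /w subrr mulr0.
  by rewrite /Rintegral integral0.
rewrite powR0 ?invr_eq0 ?pnatr_eq0// mul0r => EN.
have := Xh0_gagliardo_nirenberg hOmega hTh s_nondeg s_affine q2 hCq_opt Xd.
set G := _ `^ 2^-1 in EN *.
have G0 : G = 0.
  apply/eqP; rewrite -sqrf_eq0 eq_le sqr_ge0 andbT.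
  by apply: le_trans EN; rewrite lerDl; exact: mono_ip_ge0.
rewrite G0 powR0; last by rewrite gt_eqF// divr_gt0//; lra.
rewrite mulr0 => Q0.
have {}Q0 : \int[leb2]_(x in Omega) (`|dl x| `^ qexp r) = 0.
  apply: (@powR_eq0_eq0 _ _ (qexp r)^-1); apply/eqP.
  by rewrite eq_le Q0 powR_ge0.
(* The square of [k] is |dl|^q, so [ip_eq0] applies to the vanishing L^q norm. *)
pose k x := `|dl x| `^ (qexp r / 2).
have kk x : k x * k x = `|dl x| `^ qexp r.
  rewrite /k -powRD; last by rewrite -splitr gt_eqF.
  by rewrite -splitr.
have sk : sqi k.
  have [K dK] := Xh0_bounded hOmega hTh Xd.
  have q20 : 0 <= qexp r / 2 by rewrite divr_ge0// ltW.
  apply: (@bounded_sq_int k (K `^ (qexp r / 2))).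
    apply: (measurableT_comp (measurable_powR _)).
    by apply: measurableT_comp => //; exact: (measurable_Xh0 hOmega hTh Xd).
  move=> x _; rewrite ger0_norm ?powR_ge0//; apply: ge0_ler_powR => //.
  by rewrite nnegrE; apply: le_trans (dK x).
have k0 : '<| k, k |> <= 0.
  have -> : '<| k, k |> = \int[leb2]_(x in Omega) (`|dl x| `^ qexp r).
    by apply: eq_Rintegral => x _; exact: kk.
  by rewrite Q0.
have ae0 : {ae leb2, forall x, Omega x -> dl x = 0}.
  have := ip_eq0 mO sk k0; apply: filterS => x H Ox.
  by apply/normr0_eq0; exact: powR_eq0_eq0 (H Ox).
apply/funext => x; apply/eqP; rewrite -subr_eq0; apply/eqP.
exact: (Xh0_ae_eq0 Xd ae0).
Qed.

Lemma remainder_estimate (alpha : R) (y ybar u ubar p dl w : plane R -> R) :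
  0 < alpha -> dl = (fun x => y x - ybar x) -> w = (fun x => u x - ubar x) ->
  Xh0 y -> Xh0 ybar -> Xh0 p -> in_L2 Omega u -> in_L2 Omega ubar ->
  solves_state Omega Th phi u y -> solves_state Omega Th phi ubar ybar ->
  eta alpha r M Cq *
    '<| p, fun x => phi (y x) - phi (ybar x) - derive1 phi (ybar x) * dl x |> <=
  (\int[leb2]_(x in Omega) (`|p x| `^ qexp r)) `^ (qexp r)^-1 *
    (2^-1 * '<| dl, dl |> + alpha / 2 * '<| w, w |>).
Proof.
move=> a0 dlE wE Xy Xb Xp lu lb Sy Sb.
have Xd : Xh0 dl by rewrite dlE; exact: (Xh0B hOmega hTh).
have q2 := qexp_gt2 hr; have q0 : 0 < qexp r by lra.
have r1 : 1 < r := hr.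
have r0 : 0 < r by lra.
have r10 : 0 < r - 1 by lra.
pose c := ((r - 1) / (2 * r - 1)) `^ ((r - 1) / r).
have c0 : 0 < c by rewrite powR_gt0// divr_gt0//; lra.
have Mc0 : 0 < M * c by rewrite mulr_gt0.
(* The relation between Hoelder exponents that determines [qexp r]. *)
have l2E : (qexp r)^-1 + (qexp r)^-1 * (2 - 2 / r) + r^-1 = 1.
  by rewrite /qexp; field; rewrite !gt_eqF//; lra.
have l20 : 0 < (qexp r)^-1 * (2 - 2 / r).
  by rewrite mulr_gt0 ?invr_gt0// subr_gt0 ltr_pdivrMr//; lra.
have l10 : 0 < (qexp r)^-1 by rewrite invr_gt0.
have l30 : 0 <= r^-1 by rewrite invr_ge0 ltW.
set rm := fun x => phi (y x) - phi (ybar x) - _.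
have lrm : sqi rm.
  apply: (sq_intB mO (sq_intB mO (phi_sq_int Xy) (phi_sq_int Xb))).
  exact: (phi'_mul_sq_int Xb Xd).
have lp : sqi p := Xh0_sq_int Xp.
have ld : sqi dl := Xh0_sq_int Xd.
pose psi x := (phi (y x) - phi (ybar x)) * dl x.
have psi0 x : 0 <= psi x by rewrite /psi dlE; exact: mono_sub_mul_ge0.
have ipsi : leb2.-integrable Omega (EFin \o psi).
  exact: (sq_int_mul mO (sq_intB mO (phi_sq_int Xy) (phi_sq_int Xb)) ld).
have iq f (fX : Xh0 f) := Xh0_powR_integrable hOmega hTh q0 fX.
set P := _ `^ (qexp r)^-1; set B := '<| fun x => phi (y x) - phi (ybar x), dl |>.
have HE := energy_le dlE wE Xy Xb lu lb Sy Sb.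
have HG := Xh0_gagliardo_nirenberg hOmega hTh s_nondeg s_affine q2 hCq_opt Xd.
have B0 : 0 <= B by rewrite /B dlE; exact: mono_ip_ge0.
have rem : '<| p, rm |> <= M * c * (P *
    ((\int[leb2]_(x in Omega) (`|dl x| `^ qexp r)) `^ (qexp r)^-1) `^ (2 - 2 / r) *
    B `^ r^-1).
  (* Dividing by M c leaves a pointwise bound by a pure product of powers, the form that [hoelder3]
     takes. *)
  pose F x := (M * c)^-1 * (p x * rm x).
  have iprm := sq_int_mul mO lp lrm.
  have iF : leb2.-integrable Omega (EFin \o F) by exact: (integrableZl mO (M * c)^-1 iprm).
  have FE : \int[leb2]_(x in Omega) F x = (M * c)^-1 * '<| p, rm |>.
    exact: (@RintegralZl _ _ _ leb2 Omega (fun x => p x * rm x) (M * c)^-1 mO iprm).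
  have H := @hoelder3 _ _ _ leb2 Omega F (fun x => `|p x| `^ qexp r) (fun x => `|dl x| `^ qexp r)
    psi _ _ _ mO l10 l20 l30 l2E iF (iq _ Xp) (iq _ Xd) ipsi.
  have abc0 x : Omega x -> [/\ 0 <= `|p x| `^ qexp r, 0 <= `|dl x| `^ qexp r & 0 <= psi x].
    by move=> _; split => //; exact: powR_ge0.
  have Fle x : Omega x -> F x <= (`|p x| `^ qexp r) `^ (qexp r)^-1 *
      (`|dl x| `^ qexp r) `^ ((qexp r)^-1 * (2 - 2 / r)) * psi x `^ r^-1.
    move=> _; rewrite /F ler_pdivrMl//.
    rewrite [(`|dl x| `^ _) `^ _]powRrM -!(powRrM _ (qexp r)) mulfV ?gt_eqF// !powRr1//.
    apply: le_trans (ler_norm _) _; rewrite normrM mulrCA -!mulrA ler_wpM2l//.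
    have := @taylor_remainder R phi r M (ybar x) (y x) hphi hphi_mono hr hM hphi2.
    rewrite /rm /psi dlE -/c => /le_trans; apply.
    by rewrite le_eqVlt; apply/orP; left; apply/eqP; ring.
  have := H abc0 Fle; rewrite FE (powRrM _ _ (2 - 2 / r)) (ler_pdivrMl _ _ Mc0).
  exact.
have := eta_estimate a0 hr hM hCq (powR_ge0 _ _) (powR_ge0 _ _) (powR_ge0 _ _)
  (powR_ge0 _ _) B0 (powR_ge0 _ _) HG HE rem.
by rewrite (sqrt_sqr (ip_ge0 leb2 Omega dl)) (sqrt_sqr (ip_ge0 leb2 Omega w)).
Qed.

Lemma ip_sqrD a b : sqi a -> sqi b ->
  '<| fun x => a x + b x, fun x => a x + b x |> = '<| a, a |> + 2 * '<| b, a |> + '<| b, b |>.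
Proof.
move=> la lb; have lab := sq_intD mO la lb.
rewrite (ipD mO la lb lab) (ipC _ _ a) (ipC _ _ b) (ipD mO la lb la) (ipD mO la lb lb).
rewrite (ipC _ _ a b).
have arith (t1 t2 t3 : R) : t1 + t2 + (t2 + t3) = t1 + 2 * t2 + t3 by ring.
exact: arith.
Qed.

(** The letters stand for the inner products in [objective_gap]. The first-order part of the
    objective is YD + alpha UW; eliminating G1 + G2 between the adjoint and state relations gives YD
    + alpha UW = (WP + alpha UW) - (PH - PD) - S, where the first bracket and -S are nonnegative. *)
Lemma gap_arith (alpha S G1 G2 PD YD PH WP UW DD WW EE UU : R) :
  S <= 0 -> G1 + G2 + PD = YD + S -> G1 + G2 + PH = WP -> 0 <= WP + alpha * UW ->
  2^-1 * DD + alpha / 2 * WW - (PH - PD) <=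
  2^-1 * (DD + 2 * YD + EE) + alpha / 2 * (WW + 2 * UW + UU) - (2^-1 * EE + alpha / 2 * UU).
Proof. by move=> *; lra. Qed.

(** The objective is quadratic in the pair (y, u), so its expansion at (ybar, ubar) is exact and the
    nonlinearity enters only through the remainder of [phi]. [S] is the multiplier term of the
    adjoint equation tested with [dl]. *)
Lemma objective_gap (alpha S : R) (y0 y ybar u ubar p dl w : plane R -> R) :
  dl = (fun x => y x - ybar x) -> w = (fun x => u x - ubar x) ->
  Xh0 y -> Xh0 ybar -> Xh0 p -> in_L2 Omega y0 -> in_L2 Omega u -> in_L2 Omega ubar ->
  solves_state Omega Th phi u y -> solves_state Omega Th phi ubar ybar ->
  \int[leb2]_(x in Omega) (grad_dot p dl x + derive1 phi (ybar x) * p x * dl x) =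
    \int[leb2]_(x in Omega) ((ybar x - y0 x) * dl x) + S -> S <= 0 ->
  0 <= \int[leb2]_(x in Omega) ((p x + alpha * ubar x) * w x) ->
  2^-1 * '<| dl, dl |> + alpha / 2 * '<| w, w |> -
    '<| p, fun x => phi (y x) - phi (ybar x) - derive1 phi (ybar x) * dl x |> <=
  (2^-1 * '<| fun x => y x - y0 x, fun x => y x - y0 x |> + alpha / 2 * '<| u, u |>) -
  (2^-1 * '<| fun x => ybar x - y0 x, fun x => ybar x - y0 x |> + alpha / 2 * '<| ubar, ubar |>).
Proof.
move=> dlE wE Xy Xb Xp /in_L2_sq_int l0 lu lb Sy Sb Adj S0 Var.
have Xd : Xh0 dl by rewrite dlE; exact: (Xh0B hOmega hTh).
have ly := Xh0_sq_int Xy; have lyb := Xh0_sq_int Xb.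
have lp := Xh0_sq_int Xp; have ld := Xh0_sq_int Xd.
have lu' := in_L2_sq_int lu; have lb' := in_L2_sq_int lb.
have lw : sqi w by rewrite wE; exact: (sq_intB mO).
have le := sq_intB mO lyb l0.
have lph := phi_sq_int Xy; have lphb := phi_sq_int Xb.
have lpp := phi'_mul_sq_int Xb Xp.
have lpd := phi'_mul_sq_int Xb Xd.
have A1 := Adj; rewrite (grad_ip Xp Xd lpp) in A1.
have A2 := state_sub Xy Xb Xp lu lb Sy Sb.
rewrite -dlE -wE in A2.
have A3 : 0 <= '<| p, w |> + alpha * '<| ubar, w |>.
  rewrite -(ipZ mO alpha lb' lw) -(ipD mO lp (sq_intZ mO alpha lb') lw).
  exact: Var.
have A4 : '<| p, fun x => phi (y x) - phi (ybar x) - derive1 phi (ybar x) * dl x |> =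
  '<| fun x => phi (y x) - phi (ybar x), p |> -
  '<| fun x => derive1 phi (ybar x) * p x, dl |>.
  rewrite ipC (ipB mO (sq_intB mO lph lphb) lpd lp); congr (_ - _).
  by apply: eq_Rintegral => x _; rewrite mulrAC.
have A5 := ip_sqrD ld le.
have A6 := ip_sqrD lw lb'.
have E5 : (fun x => dl x + (ybar x - y0 x)) = (fun x => y x - y0 x).
  by apply/funext => x; rewrite dlE /=; ring.
have E6 : (fun x => w x + ubar x) = u by apply/funext => x; rewrite wE /= subrK.
rewrite E5 in A5; rewrite E6 in A6; rewrite A4 A5 A6.
have A1' : '<| gr s e1 p, gr s e1 dl |> + '<| gr s e2 p, gr s e2 dl |> +
  '<| fun x => derive1 phi (ybar x) * p x, dl |> = '<| fun x => ybar x - y0 x, dl |> + S.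
  exact: A1.
rewrite (ipC leb2 Omega (gr s e1 p)) (ipC leb2 Omega (gr s e2 p)) in A1'.
rewrite (ipC leb2 Omega w p) in A2.
exact: (gap_arith _ _ _ _ S0 A1' A2 A3).
Qed.

End Estimate.

Theorem theorem3p1 (R : realType)
    (Omega : set (plane R)) (hOmega : convex_polygonal_domain Omega)
    (alpha : R) (halpha : 0 < alpha)
    (y0 : plane R -> R) (hy0 : in_L2 Omega y0)
    (phi : R -> R) (hphi : class_C2 phi)
    (hphi_mono : {homo phi : s t / s <= t})
    (r M : R) (hr : 1 < r) (hM : 0 < M)
    (hphi2 : forall s, `|derive1 (derive1 phi) s| <= M * (derive1 phi s) `^ r^-1)
    (K : set (plane R)) (hK : compact K) (hKOmega : K `<=` Omega)
    (ya yb : plane R -> R) (hya : in_C0 Omega ya) (hyb : in_C0 Omega yb)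
    (hyab : forall x, K x -> ya x < yb x)
    (ua ub : \bar R) (huab : (ua <= ub)%E)
    (n : nat) (Th : 'I_n -> 'I_3 -> plane R)
    (hTh : conforming_triangulation Omega Th)
    (Cq : R) (hCq : 0 < Cq) (hCq_opt : (gn_optimal (qexp r) <= Cq%:E)%E)
    (ubar ybar pbar mubar : plane R -> R)
    (hubar : in_Uad Omega ua ub ubar)
    (hybar : in_Xh0 Omega Th ybar)
    (hpbar : in_Xh0 Omega Th pbar)
    (hybar_ad : in_Yad (state_nodes K Th) ya yb ybar)
    (hstate : forall v, in_Xh0 Omega Th v ->
      \int[leb2]_(x in Omega) (grad_dot ybar v x + phi (ybar x) * v x) =
      \int[leb2]_(x in Omega) (ubar x * v x))
    (hadjoint : forall v, in_Xh0 Omega Th v ->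
      \int[leb2]_(x in Omega)
        (grad_dot pbar v x + derive1 phi (ybar x) * pbar x * v x) =
      \int[leb2]_(x in Omega) ((ybar x - y0 x) * v x) +
        \sum_(x \in state_nodes K Th) mubar x * v x)
    (hvarineq : forall u, in_Uad Omega ua ub u ->
      0 <= \int[leb2]_(x in Omega)
             ((pbar x + alpha * ubar x) * (u x - ubar x)))
    (hmult : forall z, in_Yad (state_nodes K Th) ya yb z ->
      \sum_(x \in state_nodes K Th) mubar x * (z x - ybar x) <= 0) :
  ((Lp_norm Omega (qexp r) pbar <= (eta alpha r M Cq)%:E)%E ->
     global_minimum Omega K Th phi y0 ya yb ua ub alpha ubar) /\
  ((Lp_norm Omega (qexp r) pbar < (eta alpha r M Cq)%:E)%E ->
     global_minimum Omega K Th phi y0 ya yb ua ub alpha ubar /\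
     forall u, global_minimum Omega K Th phi y0 ya yb ua ub alpha u ->
       {ae leb2, forall x, Omega x -> u x = ubar x}).

Proof.
have [s [s_nondeg s_affine]] := Xh0_locally_affine hOmega hTh.
have mO : measurable (Omega : set (measurableTypeR R * measurableTypeR R)).
  exact: measurable_Omega.
have q2 := qexp_gt2 hr; have q0 : 0 < qexp r by lra.
have eta0 := eta_gt0 halpha hr hM hCq.
have [lubar _] := hubar.
(* [Gh] selects some solution of the discrete equation; uniqueness identifies it with [ybar]. *)
have Gbar : Gh Omega Th phi ubar = ybar.
  have [GX GS] := @xgetPex _ (cst 0) [set y | in_Xh0 Omega Th y /\ solves_state Omega Th phi ubar y]
    (ex_intro _ ybar (conj hybar hstate)).
  exact: (state_unique hOmega hTh s_nondeg s_affine hphi hphi_mono hr hCq_opt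
    lubar GX hybar GS hstate).
have feas : feasible Omega K Th phi ya yb ua ub ubar by rewrite /feasible Gbar.
pose J y u := 2^-1 * ip leb2 Omega (fun x => y x - y0 x) (fun x => y x - y0 x) +
  alpha / 2 * ip leb2 Omega u u.
have JE u : feasible Omega K Th phi ya yb ua ub u ->
    Jh Omega Th phi y0 alpha u = J (Gh Omega Th phi u) u.
  move=> [[lu _] GX _ _]; rewrite /Jh /J.
  have [_ iu] := in_L2_sq_int hOmega lu.
  have [_ iy] := sq_intB mO (Xh0_sq_int hOmega hTh GX) (in_L2_sq_int hOmega hy0).
  by rewrite (fine_Lp_norm2 mO iu) (fine_Lp_norm2 mO iy).
pose P := (\int[leb2]_(x in Omega) (`|pbar x| `^ qexp r)) `^ (qexp r)^-1.
have PE : Lp_norm Omega (qexp r) pbar = P%:E.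
  exact: (Lp_norm_fin q0 mO (Xh0_powR_integrable hOmega hTh q0 hpbar)).
pose gap u := 2^-1 * ip leb2 Omega (fun x => Gh Omega Th phi u x - ybar x)
    (fun x => Gh Omega Th phi u x - ybar x) +
  alpha / 2 * ip leb2 Omega (fun x => u x - ubar x) (fun x => u x - ubar x).
have gap_w u : alpha / 2 * ip leb2 Omega (fun x => u x - ubar x) (fun x => u x - ubar x) <= gap u.
  by rewrite lerDr mulr_ge0// ip_ge0.
have gap0 u : 0 <= gap u.
  by apply: le_trans (gap_w u); rewrite mulr_ge0 ?ip_ge0// divr_ge0// ltW.
(* One inequality serves both claims: P <= eta makes the left side nonnegative, and P < eta lets it
   control the gap itself. *)
have main u : feasible Omega K Th phi ya yb ua ub u ->
    (eta alpha r M Cq - P) * gap u <=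
    eta alpha r M Cq * (Jh Omega Th phi y0 alpha u - Jh Omega Th phi y0 alpha ubar).
  move=> fu; rewrite (JE u fu) (JE ubar feas) Gbar.
  have [[lu uU] GX GS GY] := fu.
  have rem := remainder_estimate hOmega hTh s_nondeg s_affine hphi hphi_mono hr hM hphi2 hCq hCq_opt
    halpha erefl erefl GX hybar hpbar lu lubar GS hstate.
  (* Here [S] is the multiplier sum, and S <= 0 is the complementarity condition at the nodal values
     of the feasible state. *)
  have obj := objective_gap hOmega hTh s_nondeg s_affine hphi erefl erefl
    GX hybar hpbar hy0 lu lubar GS hstate (hadjoint _ (Xh0B hOmega hTh GX hybar)) (hmult _ GY) (hvarineq _ (conj lu uU)).
  have := ler_wpM2l (ltW eta0) obj; rewrite -/(J (Gh Omega Th phi u) u) -/(J ybar ubar).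
  apply: le_trans; rewrite mulrBl mulrBr lerD2l lerN2; exact: rem.
have glob : P <= eta alpha r M Cq -> global_minimum Omega K Th phi y0 ya yb ua ub alpha ubar.
  move=> Peta; split => // u fu; rewrite -subr_ge0 -(pmulr_rge0 _ eta0).
  by apply: le_trans (main u fu); rewrite mulr_ge0// subr_ge0.
rewrite PE; split; first by rewrite lee_fin; exact: glob.
rewrite lte_fin => Peta; split; first exact: glob (ltW Peta).
move=> u [fu umin].
(* Minimality of [u] against the feasible [ubar] makes the right side of [main] nonpositive; the
   control part of the gap then forces u = ubar almost everywhere. *)
have gap_le0 : gap u <= 0.
  rewrite -(pmulr_rle0 _ (_ : 0 < eta alpha r M Cq - P)) ?subr_gt0//.
  apply: le_trans (main u fu) _; rewrite pmulr_rle0// subr_le0.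
  exact: umin.
have [[lu _] _ _ _] := fu.
have sw := sq_intB mO (in_L2_sq_int hOmega lu) (in_L2_sq_int hOmega lubar).
have w0 : ip leb2 Omega (fun x => u x - ubar x) (fun x => u x - ubar x) <= 0.
  have a20 : 0 < alpha / 2 by rewrite divr_gt0.
  by rewrite -(pmulr_rle0 _ a20); exact: le_trans (gap_w u) gap_le0.
by have := ip_eq0 mO sw w0; apply: filterS => x H /H /subr0_eq.
Qed.
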